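(* Let $\mu$ be a Radon measure on $\mathbb{R}^n$ and let $t\in[0,1)$. Then the measure $$\mu^t_{+}:=\mu\llcorner\left\{x\in\mathbb{R}^n: 0<\liminf_{r\downarrow 0} \frac{\mu(B(x,r))}{r^t} \leq \limsup_{r\downarrow 0} \frac{\mu(B(x,r))}{r^t}<\infty\right\}$$ is carried by bi-Lipschitz curves.
   Context: A Radon measure on $\mathbb{R}^n$ is a locally finite Borel regular outer measure. $B(x,r)$ is the closed ball with center $x$ and radius $r$. The restriction $\mu\llcorner E$ is defined by $(\mu\llcorner E)(F)=\mu(E\cap F)$ for all $F\subseteq\mathbb{R}^n$. A set $\Gamma\subseteq\mathbb{R}^n$ is a bi-Lipschitz curve if $\Gamma=f([0,1])$ for some map $f:[0,1]\to\mathbb{R}^n$ for which there is $1\le L<\infty$ with $L^{-1}|x-y|\le|f(x)-f(y)|\le L|x-y|$ for all $x,y\in[0,1]$. A measure $\nu$ on $\mathbb{R}^n$ is carried by bi-Lipschitz curves if there exist countably many bi-Lipschitz curves $\Gamma_i\subseteq\mathbb{R}^n$ with $\nu(\mathbb{R}^n\setminus\bigcup_i\Gamma_i)=0$. *)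

(* Defs.v *)
From HB Require Import structures.
From mathcomp Require Import all_boot all_order all_algebra.
From mathcomp Require Import all_classical all_reals all_analysis.

Set Implicit Arguments.
Unset Strict Implicit.
Unset Printing Implicit Defensive.

Import Order.TTheory GRing.Theory Num.Theory.
Import numFieldTopology.Exports numFieldNormedType.Exports.

Local Open Scope classical_set_scope.
Local Open Scope ring_scope.
Local Open Scope ereal_scope.

(* The norm that the library puts on row vectors is the max-norm, so the
   Euclidean norm is defined here; both induce the topology of ['rV[R]_n]. *)
Definition enorm (R : realType) (n : nat) (x : 'rV[R]_n) : R :=
  Num.sqrt (\sum_(i < n) x ord0 i ^+ 2)%R.

Definition eclosed_ball (R : realType) (n : nat) (x : 'rV[R]_n) (r : R) :
    set 'rV[R]_n :=
  [set y | (enorm (y - x) <= r)%R].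

Definition borel_set (T : topologicalType) : set (set T) :=
  <<s [set U : set T | open U] >>.

Definition locally_finite (R : realType) (T : topologicalType)
    (mu : set T -> \bar R) : Prop :=
  forall x : T, exists2 U, nbhs x U & mu U < +oo.

Definition borel_regular (R : realType) (T : topologicalType)
    (mu : set T -> \bar R) : Prop :=
  (forall B, borel_set B -> mu.-caratheodory B) /\
  (forall A, exists B, [/\ borel_set B, A `<=` B & mu B = mu A]).

Definition radon (R : realType) (T : topologicalType)
    (mu : {outer_measure set T -> \bar R}) : Prop :=
  locally_finite mu /\ borel_regular mu.

(* The library's [mrestr] restricts a measure on a sigma-algebra to a
   measurable set; here an outer measure is restricted to an arbitrary set. *)
Definition orestr (R : realType) (T : Type)
    (mu : {outer_measure set T -> \bar R}) (E : set T) : set T -> \bar R :=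
  fun F => mu (E `&` F).

Section orestr_outer_measure.
Variables (R : realType) (T : Type).
Variables (mu : {outer_measure set T -> \bar R}) (E : set T).

Let orestr0 : orestr mu E set0 = 0.
Proof. by rewrite /orestr setI0 outer_measure0. Qed.

Let orestr_ge0 F : 0 <= orestr mu E F.
Proof. exact: outer_measure_ge0. Qed.

Let le_orestr : {homo orestr mu E : A B / A `<=` B >-> A <= B}.
Proof. by move=> A B AB; apply: le_outer_measure; exact: setIS. Qed.

Let orestr_sigma_subadditive : sigma_subadditive (orestr mu E).
Proof.
by move=> F; rewrite /orestr setI_bigcupr; exact: outer_measure_sigma_subadditive.
Qed.

HB.instance Definition _ := isOuterMeasure.Build R T (orestr mu E)
  orestr0 orestr_ge0 le_orestr orestr_sigma_subadditive.

End orestr_outer_measure.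

(* [f] is a total function, but only its values on [0, 1] matter. *)
Definition bilipschitz_curve (R : realType) (n : nat) (G : set 'rV[R]_n) :
    Prop :=
  exists2 f : R -> 'rV[R]_n,
    (exists2 L : R, (1 <= L)%R &
      forall x y : R, `[0%R, 1%R]%classic x -> `[0%R, 1%R]%classic y ->
        (L^-1 * `|x - y| <= enorm (f x - f y) <= L * `|x - y|)%R) &
    G = f @` `[0%R, 1%R].

Definition carried_by_bilipschitz_curves (R : realType) (n : nat)
    (nu : {outer_measure set 'rV[R]_n -> \bar R}) : Prop :=
  exists C : set (set 'rV[R]_n),
    [/\ countable C, C `<=` @bilipschitz_curve R n &
        nu (~` \bigcup_(G in C) G) = 0].

Definition density_ratio (R : realType) (n : nat)
    (mu : {outer_measure set 'rV[R]_n -> \bar R}) (t : R) (x : 'rV[R]_n)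
    (r : R) : \bar R :=
  mu (eclosed_ball x r) / (r `^ t)%:E.

Definition lower_density (R : realType) (n : nat)
    (mu : {outer_measure set 'rV[R]_n -> \bar R}) (t : R) (x : 'rV[R]_n) :
    \bar R :=
  limf_einf (density_ratio mu t x) (at_right (0 : R)).

Definition upper_density (R : realType) (n : nat)
    (mu : {outer_measure set 'rV[R]_n -> \bar R}) (t : R) (x : 'rV[R]_n) :
    \bar R :=
  limf_esup (density_ratio mu t x) (at_right (0 : R)).

Definition mu_t_plus (R : realType) (n : nat)
    (mu : {outer_measure set 'rV[R]_n -> \bar R}) (t : R) :
    {outer_measure set 'rV[R]_n -> \bar R} :=
  orestr mu [set x | [/\ 0 < lower_density mu t x,
                         lower_density mu t x <= upper_density mu t x &
                         upper_density mu t x < +oo]].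

(* Main.v *)
Require Import Defs.
From mathcomp Require Import all_boot all_order all_algebra.
From mathcomp Require Import all_classical all_reals all_analysis.
From mathcomp Require Import ring lra.

(** Up to a countable decomposition and a restriction to small balls, one may
    replace the set of positive finite density by a set [A] all of whose points
    satisfy [r ^ t / k <= mu (B(x, r)) <= k r ^ t] at small scales. Comparing
    the measures of disjoint balls, at most [K (r / s) ^ t] points of [A] in a
    box of size [r] can be [s]-separated. Since [t < 1], the coordinates of
    these points leave gaps in every interval of length [l r], and so [A] is
    covered at every scale by boxes arranged in a grid, a definite proportion
    of their size apart, which are moreover so few that their sizes add up to
    less than that of the parent box.

    In the model situation of few separated boxes in the unit box, a curve that
    runs through the boxes along translates of the first axis is explicit: a
    shear along the first axis, by a staircase function of the other
    coordinates, gives the boxes pairwise disjoint projections to that axis;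
    the graph over the axis of a function that selects the right box is sheared
    back, and squeezed into the unit box by a radial map. Substituting such
    curves for the axes of the boxes, scale after scale, does not worsen the
    bi-Lipschitz constant, because inner curves are modified only away from
    the boundary of their box. A limit along an ultrafilter gives a
    bi-Lipschitz curve through all points of [A]. *)

Set Implicit Arguments.
Unset Strict Implicit.
Unset Printing Implicit Defensive.

Import Order.TTheory GRing.Theory Num.Theory.
Import numFieldTopology.Exports numFieldNormedType.Exports.

Local Open Scope classical_set_scope.
Local Open Scope ring_scope.

(** * The radial squeeze *)

Section Sup_norm.
Variables (R : realType) (p : nat).
Implicit Types (x y : 'rV[R]_p.+1) (r : R).

Lemma coord_le_norm x j : `|x ord0 j| <= `|x|.
Proof.
rewrite [leRHS]/Num.Def.normr /= mx_normrE; apply/bigmax_geP; right => /=.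
by exists (ord0, j).
Qed.

Lemma norm_le_coord x r : (forall j, `|x ord0 j| <= r) -> `|x| <= r.
Proof.
move=> H; rewrite [leLHS]/Num.Def.normr /= mx_normrE; apply/bigmax_leP; split=> /=.
  exact: le_trans (H ord0).
by move=> [i j] _ /=; rewrite ord1; exact: H.
Qed.

Lemma norm_lt_coord x r : (forall j, `|x ord0 j| < r) -> `|x| < r.
Proof.
move=> H; rewrite [ltLHS]/Num.Def.normr /= mx_normrE; apply/bigmax_ltP; split=> /=.
  exact: le_lt_trans (H ord0).
by move=> [i j] _ /=; rewrite ord1; exact: H.
Qed.

End Sup_norm.

Section Squeeze.
Variables (R : realType) (V : normedModType R) (q k : R).
Hypotheses (q_gt0 : 0 < q) (k_gt0 : 0 < k) (k_lt1 : k < 1).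

(** The radial profile [squeeze_factor a * a] is [min a (k * a + q)] for [a >= 0]: the identity near
    the origin and slope [k] far out. At [a = 0] the convention for division yields the factor [k],
    which only ever multiplies the zero vector. *)
Definition squeeze_factor (a : R) : R := Num.min 1 (k + q / a).
Definition squeeze (x : V) : V := squeeze_factor `|x| *: x.

Let g := squeeze_factor.

Let g_ge (a : R) : 0 <= a -> k <= g a <= 1.
Proof.
have q0 := q_gt0; have k0 := k_gt0; have k1 := k_lt1.
move=> a0; rewrite /g /squeeze_factor le_min ge_min lexx /= (ltW k_lt1) /= lerDl.
by rewrite divr_ge0 // ltW.
Qed.

Let gaE (a : R) : 0 <= a -> g a * a = Num.min a (k * a + (if a == 0 then 0 else q)).
Proof.
have q0 := q_gt0; have k0 := k_gt0; have k1 := k_lt1.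
move=> a0; rewrite /g /squeeze_factor minr_pMl // mul1r mulrDl.
by case: eqP => [->|/eqP a1]; rewrite ?mulr0 // divfK.
Qed.

Let g_anti (a b : R) : 0 < b -> b <= a -> g a <= g b.
Proof.
have q0 := q_gt0; have k0 := k_gt0; have k1 := k_lt1.
move=> b0 ba; rewrite /g /squeeze_factor le_min ge_min lexx /= ge_min.
rewrite lerD2l ler_pM2l // lef_pV2 ?posrE ?ba ?orbT //.
exact: lt_le_trans ba.
Qed.

Let g_mono (a b : R) : 0 <= b -> b <= a -> k * (a - b) <= g a * a - g b * b.
Proof.
have q0 := q_gt0; have k0 := k_gt0; have k1 := k_lt1.
move=> b0 ba; have a0 := le_trans b0 ba.
have [->|bn0] := eqVneq b 0.
  rewrite !mulr0 !subr0; apply: ler_wpM2r => //.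
  by case/andP: (g_ge a0).
have {}b0 : 0 < b by rewrite lt_neqAle eq_sym bn0.
have {}a0 := lt_le_trans b0 ba.
rewrite !gaE ?(ltW a0) ?(ltW b0) // (gt_eqF a0) (gt_eqF b0).
have kab : k * (a - b) <= a - b by rewrite ler_piMl ?subr_ge0 // ltW.
by case: (leP a) => h1; case: (leP b) => h2; lra.
Qed.

Lemma norm_squeeze x : `|squeeze x| = Num.min `|x| (k * `|x| + q).
Proof.
have q0 := q_gt0; have k0 := k_gt0; have k1 := k_lt1.
rewrite /squeeze normrZ.
have /andP[g0 _] := g_ge (normr_ge0 x).
rewrite ger0_norm ?(le_trans (ltW k_gt0)) // gaE //.
case: eqP => [->|//]; rewrite mulr0 !add0r min_l // ?min_l //.
exact: ltW.
Qed.

Lemma squeeze_id x : `|x| <= q -> squeeze x = x.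
Proof.
have q0 := q_gt0; have k0 := k_gt0; have k1 := k_lt1.
move=> xq; have [->|x0] := eqVneq x 0; first by rewrite /squeeze scaler0.
rewrite /squeeze /squeeze_factor min_l ?scale1r //.
have h : 1 <= q / `|x| by rewrite ler_pdivlMr ?normr_gt0 // mul1r.
by rewrite (le_trans h) // lerDr ltW.
Qed.

Lemma squeezeE x : q <= (1 - k) * `|x| -> squeeze x = (k + q / `|x|) *: x.
Proof.
have q0 := q_gt0; have k0 := k_gt0; have k1 := k_lt1.
move=> xq; rewrite /squeeze /squeeze_factor min_r //.
have x0 : 0 < `|x|.
  rewrite lt_neqAle normr_ge0 andbT; apply/eqP => E.
  by move: xq; rewrite -E mulr0 => h; lra.
have h : q / `|x| <= 1 - k by rewrite ler_pdivrMr.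
by rewrite -lerBrDl.
Qed.

(** For [|y| <= |x|] the factor decreases from [y] to [x], yet the radius [g a * a] still increases
    with slope at least [k]. Monotonicity of the radius therefore bounds the change of the factor by
    a multiple of [a - b <= |x - y|], and triangle inequalities give both bounds. *)
Lemma squeeze_bilip x y :
  k / 2 * `|x - y| <= `|squeeze x - squeeze y| <= 2 * `|x - y|.
Proof.
have q0 := q_gt0; have k0 := k_gt0; have k1 := k_lt1.
wlog ba : x y / `|y| <= `|x|.
  move=> H; have [/H//|/ltW/H] := leP `|y| `|x|.
  by rewrite distrC (distrC (squeeze y)).
rewrite /squeeze -/g; set a := `|x| in ba *; set b := `|y| in ba *.
have a0 : 0 <= a := normr_ge0 _; have b0 : 0 <= b := normr_ge0 _.
have /andP[ga0 ga1] := g_ge a0; have /andP[gb0 gb1] := g_ge b0.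
have mono := g_mono b0 ba.
have abxy : a - b <= `|x - y| := lerB_dist _ _.
have xy0 := normr_ge0 (x - y).
(* At the origin the factor has its conventional value, so that [g_anti] does not apply. *)
have [bz|bn0] := eqVneq b 0.
  have y0 : y = 0 by apply/normr0_eq0.
  rewrite y0 scaler0 !subr0 normrZ -/a ger0_norm; last by lra.
  by apply/andP; split; apply: ler_wpM2r => //; lra.
have bp : 0 < b by rewrite lt_neqAle eq_sym bn0.
have anti := g_anti bp ba.
have lo1 : g a * a - g b * b <= `|g a *: x - g b *: y|.
  apply: le_trans (lerB_dist _ _).
  by rewrite !normrZ -/a -/b !ger0_norm //; lra.
have lo2 : g b * `|x - y| - (g b - g a) * a <= `|g a *: x - g b *: y|.
  have -> : g a *: x - g b *: y = g b *: (x - y) - (g b - g a) *: x.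
    by rewrite scalerBr scalerBl opprB [RHS]addrC addrA subrK.
  apply: le_trans (lerB_dist _ _).
  by rewrite !normrZ !ger0_norm //; lra.
have up : `|g a *: x - g b *: y| <= g a * `|x - y| + (g b - g a) * b.
  have -> : g a *: x - g b *: y = g a *: (x - y) - (g b - g a) *: y.
    by rewrite scalerBr scalerBl opprB addrA subrK.
  apply: le_trans (ler_normB _ _) _.
  by rewrite !normrZ !ger0_norm //; lra.
have h1 : k * (`|x - y| - (a - b)) <= g b * (`|x - y| - (a - b)).
  by apply: ler_wpM2r => //; lra.
have h2 : g a * (a - b) <= g a * `|x - y|.
  by apply: ler_wpM2l => //; lra.
have h3 : g a * `|x - y| <= 1 * `|x - y| by apply: ler_wpM2r => //; lra.
have h4 : 0 <= k * (a - b) by apply: mulr_ge0; lra.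
by apply/andP; split; lra.
Qed.

End Squeeze.

(** * Reparametrization of the axis *)

Section Cutoffs.
Variable R : realType.
Implicit Types e x y : R.

Definition clamp x : R := Num.max (-1) (Num.min 1 x).
Definition bump e x : R := Num.max 0 (Num.min 1 (1 - x / e)).

Lemma clamp_incr x y : x <= y -> 0 <= clamp y - clamp x <= y - x.
Proof.
move=> xy; rewrite /clamp; apply/andP.
case: (leP 1 x) => ?; case: (leP 1 y) => ?; case: (leP (-1 : R) 1) => ?;
  try (case: (leP (-1) x) => ?); try (case: (leP (-1) y) => ?); split; lra.
Qed.

Lemma clamp_id x : `|x| <= 1 -> clamp x = x.
Proof. by rewrite ler_norml => /andP[? ?]; rewrite /clamp min_r // max_r. Qed.

Lemma clamp_ge x : 1 <= x -> clamp x = 1.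
Proof. by move=> ?; rewrite /clamp min_l // max_r //; lra. Qed.

Lemma clamp_le x : x <= -1 -> clamp x = -1.
Proof. by move=> ?; rewrite /clamp min_r ?max_l //; lra. Qed.

Lemma bump_itv e x : 0 <= bump e x <= 1.
Proof.
rewrite /bump; apply/andP.
case: (leP 1 (1 - x / e)) => ?; case: (leP (0 : R) 1) => ?;
  try (case: (leP 0 (1 - x / e)) => ?); split; lra.
Qed.

Lemma bump1 e x : 0 < e -> x <= 0 -> bump e x = 1.
Proof.
move=> e0 x0; have h : x / e <= 0 by rewrite pmulr_lle0 ?invr_gt0.
by rewrite /bump min_l ?max_r //; lra.
Qed.

Lemma bump0 e x : 0 < e -> e <= x -> bump e x = 0.
Proof.
move=> e0 x0; have h : 1 <= x / e by rewrite ler_pdivlMr // mul1r.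
by rewrite /bump min_r ?max_l //; lra.
Qed.

Lemma bump_lip e x y : 0 < e -> `|bump e x - bump e y| <= `|x - y| / e.
Proof.
move=> e0.
have -> : `|x - y| / e = `|x / e - y / e|.
  by rewrite -mulrBl normrM (@ger0_norm _ e^-1) // invr_ge0 ltW.
rewrite /bump; move: (x / e) (y / e) => a b.
wlog ab : a b / a <= b.
  by move=> H; case: (leP a b) => [/H//|/ltW/H]; rewrite distrC (distrC a).
rewrite (distrC a) (@ger0_norm _ (b - a)); last by lra.
rewrite ler_norml; apply/andP.
by case: (leP 1 (1 - a)) => ?; case: (leP 1 (1 - b)) => ?;
  do 2 ?[case: (leP (0 : R)) => ?]; split; lra.
Qed.

Lemma incr_lip_surj (C : R -> R) (k L : R) : 0 < k ->
    (forall x y, x <= y -> k * (y - x) <= C y - C x <= L * (y - x)) ->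
  forall s, exists u, C u = s.
Proof.
move=> k0 CkL s.
have L0 : 0 < L.
  have := CkL 0 1 ler01; rewrite subr0 !mulr1 => /andP[h1 h2].
  by apply: lt_le_trans k0 _; exact: le_trans h2.
have Cc : continuous C.
  move=> x; apply/cvgrPdist_le => /= e e0; near=> y.
  have h : `|x - y| <= e / L.
    near: y; apply: (@cvgr_dist_le _ R^o _ (nbhs x) _ id x) => //.
    by rewrite divr_gt0.
  have {h} : L * `|x - y| <= e by rewrite mulrC -ler_pdivlMr.
  apply: le_trans.
  case: (leP x y) => [xy|/ltW yx].
    rewrite distrC (distrC x) !ger0_norm; [by case/andP: (CkL _ _ xy)|by lra|].
    case/andP: (CkL _ _ xy) => h _; apply: le_trans h.
    by apply: mulr_ge0; lra.
  rewrite !ger0_norm; [by case/andP: (CkL _ _ yx)|by lra|].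
  case/andP: (CkL _ _ yx) => h _; apply: le_trans h.
  by apply: mulr_ge0; lra.
(* As [C] has slope at least [k], over a length [b] it moves by at least [|s| + |C 0|], which brings
   it past [s] on either side. *)
pose b := (`|s| + `|C 0|) / k.
have b0 : 0 <= b by rewrite divr_ge0 ?addr_ge0 // ltW.
have kb : k * b = `|s| + `|C 0| by rewrite mulrC divfK // gt_eqF.
have /andP[h1 _] := CkL 0 b b0.
have h0 : - b <= 0 by lra.
have /andP[h2 _] := CkL (- b) 0 h0.
have s1 := ler_norm s; have s2 := ler_norm (- s).
have c1 := ler_norm (C 0); have c2 := ler_norm (- C 0).
rewrite !normrN in s2 c2.
have hs : C (- b) <= s <= C b by apply/andP; split; lra.
have [||u _ Cu] := @IVT R C (- b) b s _ (continuous_subspaceT Cc).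
- by lra.
- by case/andP: hs => *; rewrite ge_min le_max; apply/andP; split; apply/orP;
    [left|right].
by exists u.
Unshelve. all: by end_near.
Qed.

(* The reparametrization has slope [k] away from the intervals, and just the
   slope on the [i]-th interval that makes the length of its image [2 l]. Two
   further intervals beyond [+-r1] normalize the total mass to [q]. *)
Lemma interval_reparam m (u w : 'I_m -> R) (k l c q r1 : R) :
    0 < k -> k <= l -> 0 < c -> 0 <= r1 -> m%:R * l <= q ->
    (forall i, c <= w i <= 1) ->
    (forall i j, i != j -> w i + w j <= `|u i - u j|) ->
    (forall i, `|u i| + w i <= r1) ->
  exists C : R -> R,
  [/\ forall x y, x <= y ->
        k * (y - x) <= C y - C x <= (k + m%:R * (l / c) + q) * (y - x),
      forall i x, `|x - u i| <= w i -> C x = C (u i) + l / w i * (x - u i),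
      forall x, r1 + 2 <= x -> C x = k * x + q &
      forall x, x <= - (r1 + 2) -> C x = k * x - q].
Proof.
move=> k0 kl c0 r1_ge0 mlq wc uw ur.
have w0 i : 0 < w i by case/andP: (wc i) => h _; exact: lt_le_trans h.
(* On its interval the [i]-th ramp adds the slope [a i / w i], which completes [k] to [l / w i]. *)
pose a i := l - k * w i.
have a0 i : 0 <= a i.
  rewrite /a; have /andP[_ wi] := wc i.
  have : k * w i <= k * 1 by rewrite ler_pM2l.
  by rewrite mulr1 subr_ge0 => h; exact: le_trans kl.
have al i : a i <= l by rewrite /a gerBl mulr_ge0 // ltW.
have [S SE] : exists S, S = \sum_i a i by eexists.
have S0 : 0 <= S by rewrite SE; apply: sumr_ge0 => i _.
have Sq : S <= q.
  rewrite SE; apply: le_trans mlq.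
  apply: le_trans (ler_sum _ (fun i _ => al i)) _.
  by rewrite sumr_const card_ord mulr_natl.
(* The two outer ramps, centred at [+-(r1 + 1)], cancel on [[-r1, r1]]; beyond both of them they add
   [2 * b = q - S] to the contribution [S] of the inner ramps. *)
pose b := (q - S) / 2.
have b0 : 0 <= b by rewrite /b; lra.
pose D x := \sum_i a i * clamp ((x - u i) / w i).
pose C x := k * x + D x + b * (clamp (x - (r1 + 1)) + clamp (x + (r1 + 1))).
have Dle x y : x <= y -> 0 <= D y - D x <= m%:R * (l / c) * (y - x).
  move=> xy; rewrite /D -sumrB.
  have H i : 0 <= a i * clamp ((y - u i) / w i) - a i * clamp ((x - u i) / w i)
      <= l / c * (y - x).
    rewrite -mulrBr.
    have [|h1 h2] := @andP _ _ (@clamp_incr ((x - u i) / w i) ((y - u i) / w i) _).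
      by rewrite ler_pM2r ?invr_gt0 ?w0 // lerD2r.
    rewrite mulr_ge0 //=.
    have {}h2 : clamp ((y - u i) / w i) - clamp ((x - u i) / w i) <= (y - x) / c.
      apply: le_trans h2 _; rewrite -mulrBl.
      have -> : y - u i - (x - u i) = y - x by lra.
      apply: ler_wpM2l; first by lra.
      by rewrite lef_pV2 ?posrE //; case/andP: (wc i).
    rewrite mulrAC -mulrA; exact: ler_pM.
  apply/andP; split.
    by apply: sumr_ge0 => i _; case/andP: (H i).
  apply: le_trans (ler_sum _ (fun i _ => proj2 (andP (H i)))) _.
  by rewrite sumr_const card_ord -[leRHS]mulrA mulr_natl.
have Dc i x : `|x - u i| <= w i -> D x = D (u i) + a i / w i * (x - u i).
  move=> xi; rewrite /D (bigD1 i) //= [in RHS](bigD1 i) //= subrr mul0r.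
  rewrite [clamp 0]clamp_id ?normr0 // mulr0 add0r clamp_id; last first.
    by rewrite normrM normfV (gtr0_norm (w0 i)) ler_pdivrMr // mul1r.
  rewrite addrC mulrAC mulrA; congr (_ + _); apply: eq_bigr => j ji.
  congr (_ * _).
  have := uw j i ji; move: xi; rewrite ler_norml => /andP[x1 x2].
  rewrite ler_normr => /orP[] h.
    rewrite !clamp_le // ler_pdivrMr // mulN1r; last by have := w0 i => ?; lra.
    by lra.
  rewrite !clamp_ge // ler_pdivlMr // mul1r; last by have := w0 i => ?; lra.
  by lra.
have r10 i : - r1 <= u i - w i /\ u i + w i <= r1.
  have := ur i; have := ler_norm (u i); have := ler_norm (- u i); rewrite normrN.
  by move=> *; split; lra.
have r1x i x : `|x - u i| <= w i -> -r1 <= x <= r1.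
  have [h1 h2] := r10 i; rewrite ler_norml => /andP[? ?]; apply/andP; split; lra.
exists C; split.
- move=> x y xy; have /andP[h1 h2] := Dle x y xy.
  have /andP[h3 h4] : 0 <= clamp (y - (r1 + 1)) - clamp (x - (r1 + 1)) <= y - x.
    have -> : y - x = y - (r1 + 1) - (x - (r1 + 1)) by lra.
    by apply: clamp_incr; lra.
  have /andP[h5 h6] : 0 <= clamp (y + (r1 + 1)) - clamp (x + (r1 + 1)) <= y - x.
    have -> : y - x = y + (r1 + 1) - (x + (r1 + 1)) by lra.
    by apply: clamp_incr; lra.
  pose z := (clamp (y - (r1 + 1)) - clamp (x - (r1 + 1)))
          + (clamp (y + (r1 + 1)) - clamp (x + (r1 + 1))).
  have Cz : C y - C x = k * (y - x) + (D y - D x) + b * z by rewrite /C /z; lra.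
  have z0 : 0 <= b * z by rewrite mulr_ge0 // /z; lra.
  have z1 : b * z <= b * (2 * (y - x)) by apply: ler_wpM2l => //; rewrite /z; lra.
  have z2 : 2 * b * (y - x) <= q * (y - x).
    by apply: ler_wpM2r; rewrite /b; lra.
  by rewrite Cz; apply/andP; split; lra.
- move=> i x xi; rewrite /C (Dc i x xi).
  have /andP[x1 x2] := r1x i x xi.
  have [u1 u2] := r10 i; have wi := w0 i.
  rewrite !(@clamp_le (_ - (r1 + 1))); [|lra..].
  rewrite !(@clamp_ge (_ + (r1 + 1))); [|lra..].
  have -> : l / w i = k + a i / w i.
    by rewrite /a mulrBl mulfK ?gt_eqF //; lra.
  by lra.
- move=> x xr; rewrite /C /D clamp_ge; last by lra.
  have Sx : \sum_i a i * clamp ((x - u i) / w i) = S.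
    rewrite SE; apply: eq_bigr => i _; rewrite clamp_ge ?mulr1 //.
    rewrite ler_pdivlMr // mul1r; have [_ h] := r10 i; lra.
  by rewrite Sx clamp_ge /b; lra.
- move=> x xr; rewrite /C /D (@clamp_le (x + _)); last by lra.
  have -> : \sum_i a i * clamp ((x - u i) / w i) = - S.
    rewrite SE -sumrN; apply: eq_bigr => i _; rewrite clamp_le ?mulrN1 //.
    by rewrite ler_pdivrMr // mulN1r; have [h _] := r10 i; lra.
  by rewrite clamp_le /b; lra.
Qed.

End Cutoffs.

(** * A curve through finitely many separated boxes *)

Section Interpolation.
Variable R : realType.

Lemma bigmax_lip (I : finType) (P : pred I) (F G : I -> R) r : 0 <= r ->
    (forall i, P i -> `|F i - G i| <= r) ->
  `|\big[Num.max/0]_(i | P i) F i - \big[Num.max/0]_(i | P i) G i| <= r.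
Proof.
move=> r0 FG; elim/big_ind2 : _ => [|a b c d|//]; first by rewrite subrr normr0.
rewrite !ler_norml => /andP[? ?] /andP[? ?]; apply/andP.
by case: (leP a c) => ?; case: (leP b d) => ?; split; lra.
Qed.

(** The function is a sum of bumps of height [c i], each falling to 0 within distance [e] of its
    interval. The gaps of length [e] ensure that on each interval only its own bump is nonzero. *)
Lemma separated_interpolation (V : normedModType R) m (u w : 'I_m -> R)
    (c : 'I_m -> V) e : 0 < e ->
    (forall i j, i != j -> w i + w j + e <= `|u i - u j|) ->
    (forall i, `|c i| <= 1) ->
  exists k : R -> V,
  [/\ forall x y, `|k x - k y| <= m%:R / e * `|x - y|,
      forall x, `|k x| <= m%:R,
      forall i x, `|x - u i| <= w i -> k x = c i &
      forall x, (forall i, w i + e <= `|x - u i|) -> k x = 0].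
Proof.
move=> e0 uw c1; pose b i x := bump e (`|x - u i| - w i).
exists (fun x => \sum_i b i x *: c i); split.
- move=> x y; rewrite -sumrB; apply: le_trans (ler_norm_sum _ _ _) _.
  have -> : m%:R / e * `|x - y| = \sum_(i < m) `|x - y| / e.
    by rewrite sumr_const card_ord -mulrA mulr_natl [e^-1 * _]mulrC.
  apply: ler_sum => i _; rewrite -scalerBl normrZ.
  rewrite -[leRHS]mulr1; apply: ler_pM => //.
  apply: le_trans (bump_lip _ _ e0) _.
  rewrite ler_pM2r ?invr_gt0 //.
  have -> : `|x - u i| - w i - (`|y - u i| - w i) = `|x - u i| - `|y - u i| by lra.
  apply: le_trans (ler_dist_dist _ _) _.
  by have -> : x - u i - (y - u i) = x - y by lra.
- move=> x; apply: le_trans (ler_norm_sum _ _ _) _.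
  rewrite -[m in leRHS]card_ord -sumr_const; apply: ler_sum => i _.
  rewrite normrZ -[leRHS]mulr1; apply: ler_pM => //.
  by have /andP[? ?] := bump_itv e (`|x - u i| - w i); rewrite ger0_norm.
- move=> i x xi; rewrite (bigD1 i) //= /b bump1 // ?subr_le0 // scale1r.
  rewrite big1 ?addr0 // => j ji; rewrite bump0 ?scale0r //.
  have := uw _ _ ji; have := ler_distD x (u j) (u i).
  by rewrite [`|u j - x|]distrC => *; lra.
- move=> x xu; apply: big1 => i _; rewrite /b bump0 ?scale0r //.
  by have := xu i => ?; lra.
Qed.

Variable p : nat.
Implicit Types (x y : 'rV[R]_p.+1).

(** For nonnegative half-widths, this is the sup-distance to the projection of the box along the
    first axis. *)
Definition rest_dist (c d y : 'rV[R]_p.+1) : R :=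
  \big[Num.max/0]_(l < p.+1 | l != ord0) (`|y ord0 l - c ord0 l| - d ord0 l).

Lemma rest_dist_lip c d x y : `|rest_dist c d x - rest_dist c d y| <= `|x - y|.
Proof.
apply: bigmax_lip => // l _.
set a := x ord0 l; set b := y ord0 l; set c' := c ord0 l; set d' := d ord0 l.
have -> : `|a - c'| - d' - (`|b - c'| - d') = `|a - c'| - `|b - c'| by lra.
apply: le_trans (ler_dist_dist _ _) _.
have -> : a - c' - (b - c') = (x - y) ord0 l by rewrite !mxE -/a -/b; lra.
exact: coord_le_norm.
Qed.

(* Boxes are given by their centers [c], [c'] and half-widths [d], [d']. *)
Definition box_sep (e : R) (c d c' d' : 'rV[R]_p.+1) : Prop :=
  ((forall l, l != ord0 -> c ord0 l = c' ord0 l /\ d ord0 l = d' ord0 l) /\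
    d ord0 ord0 + d' ord0 ord0 + e <= `|c ord0 ord0 - c' ord0 ord0|) \/
  exists2 l, l != ord0 & d ord0 l + d' ord0 l + e <= `|c ord0 l - c' ord0 l|.

(** Call the projection of a box along the first axis its column, here [z i]. Two columns either
    coincide or are [e] apart. Each column is assigned a height, and [H] is the maximum of bumps of
    these heights and of width [e]: over a column, the bumps of all the others vanish. Boxes of
    different columns are told apart by height, those of one column by their first coordinates. *)
Lemma staircase m (c d : 'I_m -> 'rV[R]_p.+1) e : 0 < e ->
    (forall i l, 0 <= d i ord0 l) ->
    (forall i j, i != j -> box_sep e (c i) (d i) (c j) (d j)) ->
  exists (H : 'rV[R]_p.+1 -> R) (h : 'I_m -> R),
  [/\ forall x y, `|H x - H y| <= 4 * m%:R / e * `|x - y|,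
      forall x, 0 <= H x <= 4 * m%:R,
      forall i, 0 <= h i <= 4 * m%:R,
      forall i y, (forall l, l != ord0 -> `|y ord0 l - c i ord0 l| <= d i ord0 l) ->
        H y = h i &
      forall i j, i != j ->
        (h i = h j /\
         d i ord0 ord0 + d j ord0 ord0 + e <= `|c i ord0 ord0 - c j ord0 ord0|) \/
        4 <= `|h i - h j|].
Proof.
move=> e0 d0 sep.
pose er (x : 'rV[R]_p.+1) := \row_l (if l == ord0 then 0 else x ord0 l).
pose z i := (er (c i), er (d i)).
pose s := [seq z i | i <- enum 'I_m].
have zs i : z i \in s by apply: map_f; rewrite mem_enum.
(* [index] finds the first occurrence, so boxes with the same column share a height. Boxes inside
   [[-1, 1]] have first coordinates in a range of length 2, so shifts that differ by 4 make their
   projections disjoint. *)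
pose h i : R := 4 * (index (z i) s)%:R.
have h_itv i : 0 <= h i <= 4 * m%:R.
  rewrite /h mulr_ge0 //= ler_pM2l // ler_nat.
  by apply: leq_trans (index_size _ _) _; rewrite size_map size_enum_ord.
pose t i y := h i * bump e (rest_dist (c i) (d i) y).
have t_itv i y : 0 <= t i y <= 4 * m%:R.
  have /andP[b0 b1] := bump_itv e (rest_dist (c i) (d i) y).
  have /andP[h0 h1] := h_itv i.
  by rewrite mulr_ge0 //= -[leRHS]mulr1; apply: ler_pM.
exists (fun y => \big[Num.max/0]_i t i y), h; split => //.
- move=> x y; apply: bigmax_lip.
    by rewrite !mulr_ge0 // invr_ge0 ltW.
  move=> i _; rewrite -mulrBr normrM; have /andP[h0 h1] := h_itv i.
  rewrite ger0_norm // -[leRHS]mulrA; apply: ler_pM => //.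
  apply: le_trans (bump_lip _ _ e0) _; rewrite mulrC ler_pM2l ?invr_gt0 //.
  exact: rest_dist_lip.
- move=> y; apply/andP; split; first exact: bigmax_ge_id.
  apply/bigmax_leP; split=> [|i _]; first by rewrite mulr_ge0.
  by case/andP: (t_itv i y).
- move=> i y yi; apply/eqP; rewrite eq_le; apply/andP; split.
    apply/bigmax_leP; split=> [|j _]; first by case/andP: (h_itv i).
    have [zz|zz] := eqVneq (z i) (z j).
      have /andP[b0 b1] := bump_itv e (rest_dist (c j) (d j) y).
      rewrite /t /h zz -[leRHS]mulr1; apply: ler_wpM2l => //.
    have ji : j != i by apply: contraNneq zz => ->.
    case: (sep _ _ ji) => [[E _]|[l l0 sl]].
      case/eqP: zz; congr pair; apply/rowP => l; rewrite !mxE; case: eqVneq => // l0;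
        by case: (E _ l0).
    rewrite /t bump0 ?mulr0 //; first by case/andP: (h_itv i).
    apply/bigmax_geP; right; exists l => //.
    have := yi _ l0; have := ler_distD (y ord0 l) (c j ord0 l) (c i ord0 l).
    by rewrite [`|c j _ _ - y _ _|]distrC => *; lra.
  have -> : h i = t i y.
    rewrite /t bump1 ?mulr1 //; apply/bigmax_leP; split=> // l l0.
    by rewrite subr_le0; apply: yi.
  exact: le_bigmax.
- move=> i j ij; have [zz|zz] := eqVneq (z i) (z j).
    left; split; first by rewrite /h zz.
    case: (sep _ _ ij) => [[]//|[l l0 sl]].
    case: zz => /rowP/(_ l) + /rowP/(_ l).
    rewrite !mxE (negbTE l0) => zc zd.
    have := d0 i l; have := d0 j l; move: sl; rewrite zc subrr normr0 => *.
    by exfalso; lra.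
  right; rewrite /h -mulrBr normrM ger0_norm // ler_peMr //.
  have : index (z i) s != index (z j) s.
    apply: contraNneq zz => E; apply/eqP.
    by rewrite -(nth_index (z i) (zs i)) E nth_index.
  rewrite neq_ltn => /orP[] lt.
    rewrite distrC ger0_norm ?subr_ge0 ?ler_nat 1?ltnW //.
    by rewrite lerBrDl natr1 ler_nat.
  rewrite ger0_norm ?subr_ge0 ?ler_nat 1?ltnW //.
  by rewrite lerBrDl natr1 ler_nat.
Qed.

End Interpolation.

Section Threading.
Variables (R : realType) (p : nat).
Local Notation V := 'rV[R]_p.+1.
Local Notation e1 := (delta_mx ord0 ord0 : V).

Definition bilip (W : normedModType R) (L : R) (f : R -> W) : Prop :=
  forall s s', `|s - s'| <= L * `|f s - f s'| /\ `|f s - f s'| <= L * `|s - s'|.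

Lemma norm_axis (a : R) : `|a *: e1| = `|a|.
Proof.
rewrite normrZ; suff -> : `|e1| = 1 by rewrite mulr1.
apply/eqP; rewrite eq_le; apply/andP; split.
  apply: norm_le_coord => l; rewrite mxE eqxx /=.
  by case: eqP => _; rewrite ?normr0 ?normr1.
by have := coord_le_norm e1 ord0; rewrite mxE !eqxx normr1.
Qed.

(* The curve is the graph of the column selector [k] over the axis, sheared
   back along the axis by the staircase [H]. *)
Lemma sheared_graph N m (c d : 'I_m -> V) e : 0 < e <= 1 -> (m <= N)%N ->
    (forall i l, 0 <= d i ord0 l) ->
    (forall i l, `|c i ord0 l| + d i ord0 l <= 1) ->
    (forall i j, i != j -> box_sep e (c i) (d i) (c j) (d j)) ->
  exists (g : R -> V) (u : 'I_m -> R),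
  [/\ bilip (1 + 4 * N%:R / e * (N%:R / e) + N%:R / e + 4 * N%:R / e) g /\
      (forall i, `|u i| + d i ord0 ord0 <= 4 * N%:R + 3),
      forall i j, i != j -> d i ord0 ord0 + d j ord0 ord0 <= `|u i - u j|,
      forall x, 4 * N%:R + 3 <= `|x| -> g x = x *: e1,
      forall x, `|g x| <= Num.max `|x| (8 * N%:R + 3) &
      forall i x,
        (`|x - u i| <= d i ord0 ord0 -> g x = c i + (x - u i) *: e1) /\
        ((forall l, `|g x ord0 l - c i ord0 l| < d i ord0 l) ->
          `|x - u i| < d i ord0 ord0)].
Proof.
move=> /andP[e0 e_le1] mN d0 cd1 sep.
have [H [h [Hlip H_itv h_itv Hh hsep]]] := staircase e0 d0 sep.
have mN' : m%:R <= N%:R :> R by rewrite ler_nat.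
(* The position on the axis that the shear carries to the center of box [i]. *)
pose u i := c i ord0 ord0 + h i - H 0.
have usep i j : i != j ->
    d i ord0 ord0 + d j ord0 ord0 + e <= `|u i - u j|.
  move=> ij; have -> : u i - u j =
      (c i ord0 ord0 - c j ord0 ord0) + (h i - h j) by rewrite /u; lra.
  case: (hsep _ _ ij) => [[-> ?]|h4]; first by rewrite subrr addr0.
  have := cd1 i ord0; have := cd1 j ord0.
  have := ler_normB (c i ord0 ord0) (c j ord0 ord0).
  have := lerB_normD (h i - h j) (c i ord0 ord0 - c j ord0 ord0).
  by rewrite [h i - h j + _]addrC => *; lra.
have u_itv i : `|u i| + d i ord0 ord0 <= 4 * N%:R + 1.
  have := cd1 i ord0; have := ler_normD (c i ord0 ord0) (h i - H 0).
  have : `|h i - H 0| <= 4 * m%:R.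
    by have := h_itv i; have := H_itv 0; rewrite ler_norml => *; lra.
  by rewrite /u addrA => *; lra.
have c1 i : `|c i| <= 1.
  by apply: norm_le_coord => l; have := cd1 i l; have := d0 i l => *; lra.
have [k [klip kN kc k0]] := separated_interpolation e0 usep c1.
(* Only the transversal part [K x] of the selected center enters the curve; the first coordinate
   comes from the shear. The summand [H 0] makes [g] the axis itself wherever [k] vanishes. *)
pose K x : V := \row_l (if l == ord0 then 0 else k x ord0 l).
pose g x : V := \row_l (if l == ord0 then x - H (K x) + H 0 else k x ord0 l).
have g_out x : 4 * N%:R + 3 <= `|x| -> g x = x *: e1.
  move=> xN.
  have kx : k x = 0.
    apply: k0 => i; have := u_itv i; have := lerB_dist x (u i) => *; lra.
  have Kx : K x = 0 by apply/rowP => l; rewrite !mxE kx; case: eqP; rewrite // mxE.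
  apply/rowP => l; rewrite !mxE Kx kx eqxx /=.
  by case: eqP => _; rewrite ?mxE ?mulr1 ?mulr0 //; lra.
have Hd x : `|H (K x) - H 0| <= 4 * N%:R.
  by have := H_itv (K x); have := H_itv 0; rewrite ler_norml => *; lra.
have eN : 0 <= N%:R / e by rewrite divr_ge0 // ltW.
have me : m%:R / e <= N%:R / e by rewrite ler_pM2r ?invr_gt0.
have me4 : 4 * m%:R / e <= 4 * N%:R / e by rewrite -!mulrA ler_pM2l.
have me40 : 0 <= 4 * m%:R / e by rewrite !mulr_ge0 // invr_ge0 ltW.
exists g, u; split => //.
- split; last by move=> i; have := u_itv i => *; lra.
  move=> x y; split.
    (* The transversal coordinates of [g x] are those of [K x]; they determine the shear [H (K x)],
       and undoing it recovers [x] in a Lipschitz way. *)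
    have KK : `|K x - K y| <= `|g x - g y|.
      apply: norm_le_coord => l; rewrite !mxE; case: eqVneq => [|l0].
        by rewrite subrr normr0.
      by have := coord_le_norm (g x - g y) l; rewrite !mxE (negbTE l0).
    have g0 := coord_le_norm (g x - g y) ord0; rewrite !mxE !eqxx in g0.
    have HK := Hlip (K x) (K y).
    have := ler_normD (x - H (K x) + H 0 - (y - H (K y) + H 0)) (H (K x) - H (K y)).
    have -> : x - H (K x) + H 0 - (y - H (K y) + H 0) + (H (K x) - H (K y)) = x - y.
      by lra.
    have h1 : 4 * m%:R / e * `|K x - K y| <= 4 * N%:R / e * `|g x - g y|.
      exact: ler_pM.
    have h2 : 0 <= N%:R / e * `|g x - g y| by rewrite mulr_ge0.
    have h3 : 0 <= 4 * N%:R / e * (N%:R / e) * `|g x - g y|.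
      by rewrite !mulr_ge0 // invr_ge0 ltW.
    by move=> *; lra.
  have h0 : `|k x - k y| <= N%:R / e * `|x - y|.
    by apply: le_trans (klip x y) _; apply: ler_wpM2r.
  have h1 : 0 <= 4 * N%:R / e * `|x - y| by rewrite !mulr_ge0 // invr_ge0 ltW.
  have h2 : 0 <= N%:R / e * `|x - y| by rewrite mulr_ge0.
  have h3 : 0 <= 4 * N%:R / e * (N%:R / e) * `|x - y|.
    by rewrite !mulr_ge0 // invr_ge0 ltW.
  have xy0 := normr_ge0 (x - y).
  apply: norm_le_coord => l; rewrite !mxE; case: eqVneq => [_|l0]; last first.
    have := coord_le_norm (k x - k y) l; rewrite !mxE => *; lra.
  have KK : `|K x - K y| <= `|k x - k y|.
    apply: norm_le_coord => l'; rewrite !mxE; case: eqVneq => [|_].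
      by rewrite subrr normr0.
    by have := coord_le_norm (k x - k y) l'; rewrite !mxE.
  have HK : `|H (K x) - H (K y)| <= 4 * N%:R / e * (N%:R / e * `|x - y|).
    apply: le_trans (Hlip _ _) _; apply: ler_pM => //; exact: le_trans h0.
  have := ler_normB (x - y) (H (K x) - H (K y)).
  have -> : x - y - (H (K x) - H (K y)) = x - H (K x) + H 0 - (y - H (K y) + H 0).
    by lra.
  by move=> *; lra.
- by move=> i j /usep => *; lra.
- move=> x; rewrite le_max.
  have [xN|xN] := leP (4 * N%:R + 3) `|x|.
    by rewrite g_out // norm_axis lexx.
  apply/orP; right; apply: norm_le_coord => l; rewrite !mxE.
  have N0 : 0 <= N%:R :> R by [].
  case: eqP => _; last first.
    by have := coord_le_norm (k x) l; have := kN x => *; lra.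
  have := ler_normB x (H (K x) - H 0); have := Hd x.
  have -> : x - (H (K x) - H 0) = x - H (K x) + H 0 by lra.
  by move=> *; lra.
- move=> i x; split.
    move=> xi; have kx := kc _ _ xi.
    have HK : H (K x) = h i.
      by apply: Hh => l l0; rewrite !mxE (negbTE l0) kx subrr normr0.
    apply/rowP => l; rewrite !mxE HK kx eqxx /=; case: eqP => [->|_].
      by rewrite mulr1 /u; lra.
    by rewrite mulr0 addr0.
  move=> gi; have HK : H (K x) = h i.
    apply: Hh => l l0; have := gi l; rewrite !mxE (negbTE l0); exact: ltW.
  have := gi ord0; rewrite !mxE eqxx HK /u.
  by have -> : x - h i + H 0 - c i ord0 ord0 = x - (c i ord0 ord0 + h i - H 0) by lra.
Qed.

End Threading.

Section Base_curve.
Variables (R : realType) (p : nat).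
Local Notation V := 'rV[R]_p.+1.
Local Notation e1 := (delta_mx ord0 ord0 : V).

(* The sheared graph leaves the unit box between its visits to the small boxes;
   the squeeze, which is the identity near them, brings it back. *)
Lemma threading_curve N (th l c0 e : R) :
    0 < th <= 1 / 2 -> 0 < l <= 1 -> 0 < c0 -> 0 < e <= 1 ->
  exists2 L : R, 0 < L &
  forall m (c d : 'I_m -> V), (m <= N)%N -> m%:R * l <= 1 / 4 ->
    (forall i j, c0 <= d i ord0 j) ->
    (forall i j, `|c i ord0 j| + d i ord0 j <= 1 - th) ->
    (forall i j, i != j -> box_sep e (c i) (d i) (c j) (d j)) ->
  exists (f : R -> V) (sg : 'I_m -> R),
  [/\ bilip L f,
      forall s, (1 - th / 2 <= `|s| -> f s = s *: e1) /\
                (`|s| <= 1 - th / 2 -> `|f s| <= 1 - th / 2),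
      forall i s, `|s - sg i| <= l ->
        f s = c i + ((s - sg i) / l * d i ord0 ord0) *: e1,
      forall i s, l <= `|s - sg i| ->
        exists j, d i ord0 j <= `|f s ord0 j - c i ord0 j| &
      forall i, `|sg i| + l < 1 - th / 2].
Proof.
move=> /andP[th0 th1] /andP[l0 l1] c00 e01; have /andP[e0 e_le1] := e01.
have N0 : 0 <= N%:R :> R by [].
have il0 : 0 < l^-1 by rewrite invr_gt0.
(* The detours of the sheared graph stay within radius [r], and there the squeeze reaches at most
   [k * r + (1 - th) = 1 - th / 2]. The summand [l^-1] guarantees [k <= l], as the reparametrization
   demands. *)
have [r rE] : exists r, r = 8 * N%:R + 8 + l^-1 by eexists.
have r0 : 0 < r by lra.
have [k kE] : exists k, k = th / (2 * r) by eexists.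
have k0 : 0 < k by rewrite kE divr_gt0 // mulr_gt0.
have kr : k * r = th / 2 by rewrite kE invfM mulrA divfK ?gt_eqF.
have k1 : k < 1.
  have : k * 8 <= k * r by rewrite ler_pM2l //; lra.
  by move=> *; lra.
have kl : k <= l.
  have lr : 1 <= l * r.
    have : l * l^-1 <= l * r by rewrite ler_pM2l //; lra.
    by rewrite divff ?gt_eqF.
  have : k * 1 <= k * (l * r) by rewrite ler_pM2l.
  rewrite mulr1 mulrCA kr => /le_trans; apply.
  by rewrite -[leRHS]mulr1 ler_pM2l //; lra.
have rN : 8 * N%:R + 8 <= r by rewrite rE; lra.
clear rE kE il0.
have [Lg LgE] : exists Lg,
    Lg = 1 + 4 * N%:R / e * (N%:R / e) + N%:R / e + 4 * N%:R / e.
  by eexists.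
have Lg0 : 0 < Lg.
  have h : 0 <= N%:R / e by rewrite divr_ge0 // ltW.
  have : 0 <= N%:R / e * (N%:R / e) by rewrite mulr_ge0.
  by rewrite LgE => *; lra.
have [LC LCE] : exists LC, LC = k + N%:R * (l / c0) + (1 - th) by eexists.
have LC0 : 0 < LC.
  have : 0 <= N%:R * (l / c0) by rewrite mulr_ge0 // divr_ge0 ?ltW.
  by rewrite LCE => *; lra.
have ik0 : 0 < k^-1 by rewrite invr_gt0.
exists (2 * Lg / k + 2 / k * Lg * LC).
  by rewrite addr_gt0 ?mulr_gt0.
move=> m c d mN ml dc cd sep.
have d0 i j : 0 <= d i ord0 j by apply: le_trans (dc i j); exact: ltW.
have cd1 i j : `|c i ord0 j| + d i ord0 j <= 1.
  by apply: le_trans (cd i j) _; lra.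
have [g [u [[gL u_itv] usep g_out gmax gi]]] := sheared_graph e01 mN d0 cd1 sep.
rewrite -LgE in gL; clear LgE.
have wc i : c0 <= d i ord0 ord0 <= 1.
  by rewrite dc /=; have := cd1 i ord0; have := normr_ge0 (c i ord0 ord0) => *; lra.
have r10 : 0 <= 4 * N%:R + 3 :> R by lra.
have mlq : m%:R * l <= 1 - th by lra.
(* The mass is [1 - th], so that far out [C x = k * x + (1 - th)] is exactly the radial profile of
   the squeeze. Composing the squeezed curve with the inverse [G] of [C] then gives [s *: e1] near
   the ends. *)
have [C [CL Ci Cp Cm]] := interval_reparam k0 kl c00 r10 mlq wc usep u_itv.
have {}CL x y : x <= y -> k * (y - x) <= C y - C x <= LC * (y - x).
  move=> xy; have /andP[h1 h2] := CL x y xy; rewrite h1 /=; apply: le_trans h2 _.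
  apply: ler_wpM2r; first by rewrite subr_ge0.
  rewrite LCE lerD2r lerD2l ler_wpM2r ?ler_nat //.
  by rewrite divr_ge0 ?ltW.
clear LCE.
have Clt x y : x < y -> C x < C y.
  move=> xy; have /andP[h _] := CL x y (ltW xy).
  have : 0 < k * (y - x) by rewrite mulr_gt0 // subr_gt0.
  by move=> *; lra.
have Cle x y : C x <= C y -> x <= y.
  by move=> h; rewrite leNgt; apply/negP => /Clt; rewrite ltNge h.
have /choice[G CG] := incr_lip_surj k0 CL.
have r2 : 4 * N%:R + 3 + 2 <= r by move: rN N0; clear; move=> *; lra.
have Cr : C r = 1 - th / 2 by rewrite Cp // kr; field.
have CNr : C (- r) = - (1 - th / 2) by rewrite Cm ?lerN2 // mulrN kr; field.
have GL s s' : k * `|G s - G s'| <= `|s - s'| <= LC * `|G s - G s'|.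
  wlog ss : s s' / G s' <= G s.
    move=> H; have [/H//|/ltW/H] := leP (G s') (G s).
    by rewrite distrC (distrC s).
  have := CL _ _ ss; rewrite !CG => /andP[h1 h2].
  rewrite (ger0_norm (_ : 0 <= G s - _)) ?subr_ge0 // ger0_norm ?h1 //.
  by apply: le_trans h1; rewrite mulr_ge0 ?subr_ge0 // ltW.
have q0 : 0 < 1 - th by lra.
pose f s := squeeze (1 - th) k (g (G s)).
pose sg i := C (u i).
have di0 i : 0 < d i ord0 ord0 by apply: lt_le_trans (dc i ord0).
have Gi i s : `|s - sg i| <= l -> `|G s - u i| <= d i ord0 ord0.
  have h1 : C (u i + d i ord0 ord0) = sg i + l.
    rewrite (Ci i); last by rewrite [u i + _]addrC addrK gtr0_norm.
    by rewrite [u i + _]addrC addrK divfK ?gt_eqF.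
  have h2 : C (u i - d i ord0 ord0) = sg i - l.
    rewrite (Ci i); last by rewrite [u i - _]addrC addrK normrN gtr0_norm.
    by rewrite [u i - _]addrC addrK mulrN divfK ?gt_eqF.
  rewrite ler_norml => /andP[s1 s2].
  rewrite ler_norml; apply/andP; split.
    rewrite lerBrDl; apply: Cle; rewrite h2 CG.
    by move: s1; clear; move=> *; lra.
  rewrite lerBlDl; apply: Cle; rewrite h1 CG.
  by move: s2; clear; move=> *; lra.
exists f, sg; split.
- move=> s s'.
  have /andP[g1 g2] := GL s s'; have [g3 g4] := gL (G s) (G s').
  have /andP[f1 f2] := squeeze_bilip q0 k0 k1 (g (G s)) (g (G s')).
  have k20 : 0 < k / 2 by rewrite divr_gt0.
  have ss0 := normr_ge0 (s - s'); have ff0 := normr_ge0 (f s - f s').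
  split.
    have : `|s - s'| <= 2 / k * Lg * LC * `|f s - f s'|.
      apply: le_trans g2 _.
      have -> : 2 / k * Lg * LC * `|f s - f s'| =
          LC * (Lg * ((k / 2)^-1 * `|f s - f s'|)).
        by rewrite invfM invrK; ring.
      rewrite ler_pM2l //; apply: le_trans g3 _; rewrite ler_pM2l //.
      by rewrite ler_pdivlMl.
    have : 0 <= 2 * Lg / k * `|f s - f s'| by rewrite mulr_ge0 // ltW // !mulr_gt0.
    by rewrite [(_ / k + _) * _]mulrDl => ? h; apply: le_trans h _; rewrite lerDr.
  have : `|f s - f s'| <= 2 * Lg / k * `|s - s'|.
    apply: le_trans f2 _.
    have -> : 2 * Lg / k * `|s - s'| = 2 * (Lg * (k^-1 * `|s - s'|)) by ring.
    rewrite ler_pM2l //; apply: le_trans g4 _; rewrite ler_pM2l //.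
    by rewrite ler_pdivlMl.
  have : 0 <= 2 / k * Lg * LC * `|s - s'|.
    by rewrite mulr_ge0 // ltW // !mulr_gt0.
  by rewrite [(_ / k + _) * _]mulrDl => ? h; apply: le_trans h _; rewrite lerDl.
- move=> s; split.
    move=> s1; have rG : r <= `|G s|.
      move: s1; rewrite ler_normr -Cr => /orP[] h.
        by apply: le_trans (ler_norm _); apply: Cle; rewrite CG.
      rewrite -normrN ler_normr; apply/orP; left; rewrite lerNr.
      by apply: Cle; rewrite CNr CG -Cr lerNr.
    have gG : g (G s) = G s *: e1.
      by apply: g_out; move: rG r2; clear; move=> *; lra.
    have nG : `|g (G s)| = `|G s| by rewrite gG norm_axis.
    rewrite /f squeezeE //; last first.
      rewrite nG; have k8 : k * 8 <= k * r.
        by rewrite ler_pM2l //; move: rN N0; clear; move=> *; lra.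
      have : (1 - k) * r <= (1 - k) * `|G s|.
        by apply: ler_wpM2l rG; rewrite subr_ge0 ltW.
      by move: k8 kr k1 rN N0 th0 th1; clear; move=> *; lra.
    rewrite nG gG.
    rewrite scalerA; congr (_ *: _); rewrite -{3}[s]CG.
    have G0 : `|G s| != 0 by rewrite gt_eqF //; exact: lt_le_trans rG.
    have [h|h] := leP 0 (G s).
      rewrite ger0_norm in rG G0 *; last by [].
      by rewrite Cp; [rewrite mulrDl divfK|exact: le_trans rG].
    rewrite ltr0_norm in rG G0 * => //.
    rewrite Cm; last by rewrite lerNr; exact: le_trans rG.
    by rewrite mulrDl invrN mulrN mulNr divfK // -oppr_eq0.
  move=> s1; rewrite /f norm_squeeze // ge_min; apply/orP; right.
  have Gr : `|G s| <= r.
    move: s1; rewrite !ler_norml => /andP[s1 s2]; apply/andP; split; apply: Cle.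
      by rewrite CNr CG.
    by rewrite Cr CG.
  have : `|g (G s)| <= r.
    apply: le_trans (gmax _) _; rewrite ge_max Gr /=.
    by move: rN N0; clear; move=> *; lra.
  by rewrite -(ler_pM2l k0) kr; clear; move=> *; lra.
- move=> i s si; have Gu := Gi i s si; have [gE _] := gi i (G s).
  have sE : s - sg i = l / d i ord0 ord0 * (G s - u i).
    by rewrite -{1}[s]CG (Ci i _ Gu) /sg; ring.
  rewrite /f squeeze_id //.
    rewrite gE // sE; congr (_ + _ *: _).
    by field; rewrite !gt_eqF.
  rewrite gE //; apply: norm_le_coord => j; rewrite !mxE eqxx /=.
  have := cd i j; case: eqP => [->|_] h.
    rewrite mulr1; apply: le_trans (ler_normD _ _) _; apply: le_trans h.
    by rewrite lerD2l.
  by rewrite mulr0 addr0; apply: le_trans h; rewrite lerDl.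
(* A point of [f] inside a small box has norm below [1 - th]. The squeeze sends only points of norm
   below [1 - th] there, and it fixes those; hence the sheared graph itself is in the box, and its
   parameter in the interval. *)
- move=> i s si; apply: contrapT => H.
  have {}H j : `|f s ord0 j - c i ord0 j| < d i ord0 j.
    by rewrite ltNge; apply/negP => h; apply: H; exists j.
  have fE : f s = g (G s).
    apply: squeeze_id => //.
    have : `|f s| < 1 - th.
      apply: norm_lt_coord => j; have := H j; have := cd i j.
      have := ler_normD (c i ord0 j) (f s ord0 j - c i ord0 j).
      by rewrite [c i _ _ + _]addrC subrK; clear; move=> *; lra.
    rewrite /f norm_squeeze // gt_min => /orP[/ltW//|h].
    have : 0 <= k * `|g (G s)| by rewrite mulr_ge0 // ltW.
    by move: h; clear; move=> *; lra.
  have [_ /(_ _)] := gi i (G s); rewrite -fE => /(_ H) Gu.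
  have sE : s - sg i = l / d i ord0 ord0 * (G s - u i).
    by rewrite -{1}[s]CG (Ci i _ (ltW Gu)) /sg; ring.
  move: si; rewrite sE normrM gtr0_norm ?divr_gt0 //.
  rewrite -mulrA -[leLHS]mulr1 ler_pM2l // ler_pdivlMl // mulr1 leNgt.
  by rewrite Gu.
- move=> i; have ui := u_itv i.
  have h1 : C (u i + d i ord0 ord0) = sg i + l.
    rewrite (Ci i); last by rewrite [u i + _]addrC addrK gtr0_norm.
    by rewrite [u i + _]addrC addrK divfK ?gt_eqF.
  have h2 : C (u i - d i ord0 ord0) = sg i - l.
    rewrite (Ci i); last by rewrite [u i - _]addrC addrK normrN gtr0_norm.
    by rewrite [u i - _]addrC addrK mulrN divfK ?gt_eqF.
  have := ler_norm (u i); have := ler_norm (- u i); rewrite normrN => un up.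
  have r1 : 4 * N%:R + 3 < r by move: r2; clear; move=> *; lra.
  have : sg i + l < 1 - th / 2
    by rewrite -h1 -Cr; apply: Clt; move: ui un up r1; clear; move=> *; lra.
  have : - (1 - th / 2) < sg i - l
    by rewrite -h2 -CNr; apply: Clt; move: ui un up r1; clear; move=> *; lra.
  by move=> h3 h4; rewrite -ltrBrDr ltr_norml; move: h3 h4; clear; move=> *;
    apply/andP; split; lra.
Qed.

End Base_curve.

(** * Substitution of curves into boxes *)

Section Gluing.
Variables (R : realType) (p : nat).
Local Notation V := 'rV[R]_p.+1.
Local Notation e1 := (delta_mx ord0 ord0 : V).

(* The ends of the curve are pinned to the first axis of the box and the middle
   stays away from the boundary: such a curve can replace the axis of a box on
   a curve that crosses the box along this axis. *)
Definition box_curve (eta L r : R) (c d : V) (f : R -> V) : Prop :=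
  [/\ forall s s', `|s| <= 1 -> `|s'| <= 1 ->
        r * `|s - s'| <= L * `|f s - f s'| /\
        `|f s - f s'| <= L * (r * `|s - s'|),
      forall s, 1 - eta / 2 <= `|s| -> f s = c + (s * d ord0 ord0) *: e1 &
      forall s, `|s| <= 1 - eta / 2 ->
        forall l, `|f s ord0 l - c ord0 l| <= (1 - eta / 2) * d ord0 l].

(** This starts the induction over scales. The axis is traversed at speed [d ord0 ord0], which can
    be as small as [2 * eta * r]; hence the condition on [L]. *)
Lemma box_curve_axis (eta L r : R) (c d : V) :
    0 < eta <= 1 / 2 -> 0 < r -> 1 <= 2 * eta * L ->
    (forall l, 2 * eta * r <= d ord0 l <= r) ->
  box_curve eta L r c d (fun s => c + (s * d ord0 ord0) *: e1).
Proof.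
move=> /andP[eta0 eta1] r0 L1 dr.
have d0 l : 0 <= d ord0 l.
  have /andP[h _] := dr l; apply: le_trans h.
  by rewrite !mulr_ge0 // ltW.
have L0 : 1 <= L.
  apply: (le_trans L1); rewrite ler_piMl //; last by lra.
  by have := lt_le_trans ltr01 L1; rewrite pmulr_rgt0 ?mulr_gt0 // => /ltW.
split=> //.
- move=> s s' _ _.
  have -> : c + (s * d ord0 ord0) *: e1 - (c + (s' * d ord0 ord0) *: e1) =
      ((s - s') * d ord0 ord0) *: e1.
    by rewrite opprD addrACA subrr add0r -scalerBl mulrBl.
  rewrite norm_axis normrM [`|d _ _|]ger0_norm //.
  have s0 := normr_ge0 (s - s'); have /andP[d1 d2] := dr ord0.
  split.
    have h1 : 2 * eta * r * (L * `|s - s'|) <= d ord0 ord0 * (L * `|s - s'|).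
      by apply: ler_wpM2r => //; rewrite mulr_ge0 //; lra.
    have h2 : 1 * (r * `|s - s'|) <= 2 * eta * L * (r * `|s - s'|).
      by apply: ler_wpM2r => //; rewrite mulr_ge0 //; lra.
    by lra.
  have h1 : `|s - s'| * d ord0 ord0 <= `|s - s'| * r by apply: ler_wpM2l.
  have h2 : 1 * (r * `|s - s'|) <= L * (r * `|s - s'|).
    by apply: ler_wpM2r => //; rewrite mulr_ge0 //; lra.
  by lra.
- move=> s s1 l; rewrite !mxE eqxx addrAC subrr add0r /=.
  case: eqP => [->|_].
    by rewrite mulr1 normrM [`|d _ _|]ger0_norm // ler_wpM2r.
  by rewrite mulr0 normr0 mulr_ge0 //; lra.
Qed.

Lemma box_sep_far (e : R) (c d c' d' x : V) : box_sep e c d c' d' ->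
    (forall l, `|x ord0 l - c' ord0 l| <= d' ord0 l) ->
  exists l, d ord0 l + e <= `|x ord0 l - c ord0 l|.
Proof.
case=> [[_ h]|[l _ h]] xc; [exists ord0|exists l].
  have := xc ord0; have := ler_distD (x ord0 ord0) (c ord0 ord0) (c' ord0 ord0).
  by rewrite [`|c _ _ - x _ _|]distrC => *; lra.
have := xc l; have := ler_distD (x ord0 l) (c ord0 l) (c' ord0 l).
by rewrite [`|c _ _ - x _ _|]distrC => *; lra.
Qed.

(* The inner curves and the outcome share the constant [L]: for two points in
   the same small box only the inner curve matters, and other pairs are
   displaced by an amount comparable to their distance. *)
Lemma box_curve_glue N (eta l : R) : 0 < eta <= 1 / 2 -> 0 < l <= 1 ->
  exists2 L : R, 1 <= 2 * eta * L &
  forall (r : R) (c d : V) m (ci di : 'I_m -> V) (fi : 'I_m -> R -> V),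
    0 < r -> (forall j, 2 * eta * r <= d ord0 j <= r) ->
    (m <= N)%N -> m%:R * l <= 1 / 4 ->
    (forall i j, 2 * eta * (l * r) <= di i ord0 j) ->
    (forall i j, `|ci i ord0 j - c ord0 j| + di i ord0 j <= d ord0 j - eta * r) ->
    (forall i j, i != j -> box_sep (2 * eta * (l * r)) (ci i) (di i) (ci j) (di j)) ->
    (forall i, box_curve eta L (l * r) (ci i) (di i) (fi i)) ->
  exists2 f, box_curve eta L r c d f &
    forall i s, `|s| <= 1 -> exists2 s', `|s'| <= 1 & f s' = fi i s.
Proof.
move=> eta01 l01; have /andP[eta0 eta1] := eta01; have /andP[l0 l1] := l01.
have eta2 : 1 - eta / 2 <= 1 by lra.
have c00 : 0 < 2 * eta * l by rewrite !mulr_gt0.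
have c01 : 2 * eta * l <= 1.
  have : eta * l <= 1 / 2 * 1 by apply: ler_pM => //; exact: ltW.
  by move=> *; lra.
have [|L0 L00 thread] := threading_curve p N eta01 l01 c00 (e := 2 * eta * l).
  by rewrite c00.
have a0 : 0 < (2 * eta)^-1 by rewrite invr_gt0 mulr_gt0.
have b0 : 0 < (eta * eta * l)^-1 by rewrite invr_gt0 !mulr_gt0.
have g0 : 0 < (eta * l)^-1 by rewrite invr_gt0 !mulr_gt0.
have aE : 2 * eta * (2 * eta)^-1 = 1 by rewrite divff // mulf_neq0 ?gt_eqF.
have bE : eta * eta * l * (eta * eta * l)^-1 = 1.
  by rewrite divff // !mulf_neq0 ?gt_eqF.
have gE : eta * l * (eta * l)^-1 = 1 by rewrite divff // !mulf_neq0 ?gt_eqF.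
have a1 : 1 <= (2 * eta)^-1 by rewrite invf_ge1 ?mulr_gt0 //; lra.
move: a0 b0 g0 aE bE gE a1.
move: (2 * eta)^-1 (eta * eta * l)^-1 (eta * l)^-1 => a b g a0 b0 g0 aE bE gE a1.
(* [a * L0] serves the pairs on the rescaled threading curve, [2 * b] and [4 * g] the pairs with one
   point in the core of a small box and the other outside this box, and the last [a] yields
   [1 <= 2 * eta * L]. The inner curves have no influence on this choice. *)
have [L LE] : exists L, L = a * L0 + 2 * b + 4 * g + a by eexists.
have aL0 : 0 < a * L0 by rewrite mulr_gt0.
have L1 : 1 <= 2 * eta * L by rewrite LE mulrDr aE lerDr mulr_ge0 //; lra.
have [La Lb Lg] : [/\ a * L0 <= L, 2 * b <= L & 4 * g <= L].
  by rewrite LE; split; lra.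
clear LE; exists L => //.
move=> r c d m ci di fi r0 dr mN ml di_ge cdi sep curve.
have lr0 : 0 < l * r by rewrite mulr_gt0.
have er0 : 0 < eta * r by rewrite mulr_gt0.
have elr0 : 0 < eta * (l * r) by rewrite mulr_gt0.
have d0 j : 0 < d ord0 j.
  by have /andP[h _] := dr j; apply: lt_le_trans h; rewrite -mulrA mulr_gt0.
have di0 i j : 0 < di i ord0 j.
  by apply: lt_le_trans (di_ge i j); rewrite -mulrA mulr_gt0.
(* An affine map in each coordinate turns the big box into the unit box. As [d ord0 j <= r], the
   half-widths and separations of the small boxes become at least [2 * eta * l]. *)
pose c' i : V := \row_j ((ci i ord0 j - c ord0 j) / d ord0 j).
pose d' i : V := \row_j (di i ord0 j / d ord0 j).
have norm_div x j : `|x| / d ord0 j = `|x / d ord0 j|.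
  by rewrite normrM (@gtr0_norm _ (_^-1)) ?invr_gt0.
have e_le j : 2 * eta * l * d ord0 j <= 2 * eta * (l * r).
  by rewrite -!mulrA !ler_pM2l //; case/andP: (dr j).
have [|||f0 [sg [f0L f0ends f0in f0out sg1]]] := thread m c' d' mN ml.
- move=> i j; rewrite mxE ler_pdivlMr //.
  exact: le_trans (e_le j) (di_ge i j).
- move=> i j; rewrite !mxE -norm_div -mulrDl ler_pdivrMr //.
  apply: le_trans (cdi i j) _; rewrite mulrBl mul1r lerD2l lerN2 ler_pM2l //.
  by case/andP: (dr j).
- move=> i j ij; case: (sep _ _ ij) => [[E h]|[k k0 h]]; [left; split|right].
  + by move=> k k0; rewrite !mxE; case: (E _ k0) => -> ->.
  + rewrite !mxE -mulrBl -norm_div ler_pdivlMr //.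
    rewrite [(_ + _ + _) * _]mulrDl [(_ + _) * _]mulrDl !divfK ?gt_eqF //.
    have -> : ci i ord0 ord0 - c ord0 ord0 - (ci j ord0 ord0 - c ord0 ord0) =
      ci i ord0 ord0 - ci j ord0 ord0 by ring.
    by apply: le_trans h; rewrite lerD2l; exact: e_le.
  + exists k => //; rewrite !mxE -mulrBl -norm_div ler_pdivlMr //.
    rewrite [(_ + _ + _) * _]mulrDl [(_ + _) * _]mulrDl !divfK ?gt_eqF //.
    have -> : ci i ord0 k - c ord0 k - (ci j ord0 k - c ord0 k) =
      ci i ord0 k - ci j ord0 k by ring.
    by apply: le_trans h; rewrite lerD2l; exact: e_le.
pose F0 s : V := \row_j (c ord0 j + d ord0 j * f0 s ord0 j).
have F0in i s : `|s - sg i| <= l ->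
    F0 s = ci i + ((s - sg i) / l * di i ord0 ord0) *: e1.
  move=> si; apply/rowP => j; rewrite !mxE (f0in i) // !mxE eqxx /=.
  case: eqP => [->|_]; rewrite ?mulr1 ?mulr0 ?addr0.
    rewrite mulrDr ![d _ _ * _]mulrC divfK ?gt_eqF // -[_ * d _ _]mulrA.
    by rewrite divfK ?gt_eqF //; ring.
  by rewrite [d _ _ * _]mulrC divfK ?gt_eqF //; ring.
have F0box i s : `|s - sg i| <= l ->
    forall j, `|F0 s ord0 j - ci i ord0 j| <= di i ord0 j.
  move=> si j; rewrite (F0in i) // !mxE addrAC subrr add0r eqxx /=.
  case: eqP => [->|_]; last by rewrite mulr0 normr0 ltW.
  rewrite mulr1 normrM [`|di _ _ _|]gtr0_norm // ger_pMl // normrM.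
  by rewrite (@gtr0_norm _ (_^-1)) ?invr_gt0 // ler_pdivrMr // mul1r.
have F0out i s : l <= `|s - sg i| ->
    exists j, di i ord0 j <= `|F0 s ord0 j - ci i ord0 j|.
  move=> /f0out[j]; rewrite !mxE ler_pdivrMr // => h; exists j.
  apply: le_trans h _; rewrite -[X in _ * X](gtr0_norm (d0 j)) -normrM mulrBl.
  rewrite divfK ?gt_eqF //.
  have -> : f0 s ord0 j * d ord0 j - (ci i ord0 j - c ord0 j) =
    c ord0 j + d ord0 j * f0 s ord0 j - ci i ord0 j by ring.
  by rewrite mxE.
have J_uniq i j s : `|s - sg i| <= l -> `|s - sg j| <= l -> i = j.
  move=> si sj; apply/eqP/negP => /negP ij.
  have [k] := box_sep_far (sep _ _ ij) (F0box j s sj).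
  by have := F0box i s si k; move: elr0; clear; move=> *; lra.
pose f s := if [pick i | `|s - sg i| <= l] is Some i then fi i ((s - sg i) / l)
            else F0 s.
have fin i s : `|s - sg i| <= l -> f s = fi i ((s - sg i) / l).
  rewrite /f => si; case: pickP => [j sj|/(_ i)]; last by rewrite si.
  by rewrite (J_uniq j i s).
have norm1 i s : `|(s - sg i) / l| = `|s - sg i| / l.
  by rewrite normrM (@gtr0_norm _ (_^-1)) ?invr_gt0.
(* The pinned ends of the inner curves run along the axes that they replace, so [f] and [F0] differ
   only in the cores of the intervals. *)
have fF0 s : (forall i, (1 - eta / 2) * l <= `|s - sg i|) -> f s = F0 s.
  move=> sn; rewrite /f; case: pickP => // i si.
  rewrite (F0in i) //; case: (curve i) => _ ends _; rewrite ends //.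
  by rewrite norm1 ler_pdivlMr.
have fcore i s : `|s - sg i| <= (1 - eta / 2) * l ->
    forall j, `|f s ord0 j - ci i ord0 j| <= (1 - eta / 2) * di i ord0 j.
  move=> si j; rewrite (fin i); last first.
    by apply: le_trans si _; rewrite ger_pMl.
  case: (curve i) => _ _ core; apply: core.
  by rewrite norm1 ler_pdivrMr.
have fbox i s : `|s - sg i| <= l ->
    forall j, `|f s ord0 j - ci i ord0 j| <= di i ord0 j.
  move=> si j; have [h|h] := leP `|s - sg i| ((1 - eta / 2) * l).
    by apply: le_trans (fcore _ _ h j) _; rewrite ger_pMl.
  rewrite fF0; first exact: F0box.
  move=> k; have [h'|h'] := leP `|s - sg k| l.
    by rewrite -(J_uniq i k s) // ltW.
  by apply: le_trans (ltW h'); rewrite ger_pMl.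
have fout i s : l < `|s - sg i| ->
    exists j, di i ord0 j <= `|f s ord0 j - ci i ord0 j|.
  move=> si; have [[k sk]|sn] := pselect (exists k, `|s - sg k| <= l).
    have ik : i != k by apply/eqP => ik; move: si; rewrite ik ltNge sk.
    have [j h] := box_sep_far (sep _ _ ik) (fbox _ _ sk).
    by exists j; move: h elr0; clear; move=> *; lra.
  rewrite fF0; first by apply: F0out; exact: ltW.
  move=> k; have [h|h] := leP `|s - sg k| l; first by case: sn; exists k.
  by apply: le_trans (ltW h); rewrite ger_pMl.
have fQ s : `|s| <= 1 - eta / 2 ->
    forall j, `|f s ord0 j - c ord0 j| <= (1 - eta / 2) * d ord0 j.
  move=> s1 j; have [[k sk]|sn] := pselect (exists k, `|s - sg k| <= l).
    have h1 := fbox _ _ sk j; have h2 := cdi k j.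
    have h3 := ler_distD (ci k ord0 j) (f s ord0 j) (c ord0 j).
    have h4 : eta * d ord0 j <= eta * r by rewrite ler_pM2l //; case/andP: (dr j).
    have h5 : 0 < eta * d ord0 j by rewrite mulr_gt0.
    by move: h1 h2 h3 h4 h5; clear; move=> *; lra.
  rewrite fF0; last first.
    move=> k; have [h|h] := leP `|s - sg k| l; first by case: sn; exists k.
    by apply: le_trans (ltW h); rewrite ger_pMl.
  rewrite !mxE addrAC subrr add0r normrM gtr0_norm // mulrC ler_pM2r //.
  apply: le_trans (coord_le_norm _ _) _.
  by case: (f0ends s) => _; apply.
have fend s : 1 - eta / 2 <= `|s| -> f s = c + (s * d ord0 ord0) *: e1.
  move=> s1; rewrite fF0; last first.
    move=> i; have := sg1 i; have := lerB_dist s (sg i).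
    have : 0 <= eta / 2 * l by rewrite ltW // mulr_gt0 // divr_gt0.
    by move: s1 l1; clear; move=> *; lra.
  case: (f0ends s) => /(_ s1) E _; apply/rowP => j; rewrite !mxE E !mxE eqxx /=.
  by case: eqP => [->|_]; rewrite ?mulr1 ?mulr0; ring.
have fdiam s : `|s| <= 1 -> forall j, `|f s ord0 j - c ord0 j| <= d ord0 j.
  move=> s1 j; have [h|h] := leP `|s| (1 - eta / 2).
    by apply: le_trans (fQ _ h j) _; rewrite ger_pMl.
  rewrite fend; last exact: ltW.
  rewrite !mxE addrAC subrr add0r eqxx /=.
  case: eqP => [->|_]; last by rewrite mulr0 normr0 ltW.
  by rewrite mulr1 normrM [`|d _ _|]gtr0_norm // ger_pMl.
(* If both points are in box [i], the inner curve gives the estimate, rescaled but with the same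
   [L]. Otherwise the second point has left the box, while the first stays a proportion [eta / 2]
   away from its boundary: both distances are bounded below by multiples of their trivial upper
   bounds. *)
have moved s s' i : `|s| <= 1 -> `|s'| <= 1 ->
    `|s - sg i| < (1 - eta / 2) * l ->
    r * `|s - s'| <= L * `|f s - f s'| /\ `|f s - f s'| <= L * (r * `|s - s'|).
  move=> s1 s1' si; have sil : `|s - sg i| <= l.
    by apply: le_trans (ltW si) _; rewrite ger_pMl.
  have [s'i|s'i] := leP `|s' - sg i| l.
    rewrite (fin _ _ sil) (fin _ _ s'i).
    case: (curve i) => /(_ ((s - sg i) / l) ((s' - sg i) / l)) + _ _.
    rewrite !norm1 !ler_pdivrMr // !mul1r => /(_ sil s'i).
    rewrite -mulrBl.
    have -> : s - sg i - (s' - sg i) = s - s' by ring.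
    rewrite normrM (@gtr0_norm _ (_^-1)) ?invr_gt0 //.
    by have -> : l * r * (`|s - s'| / l) = r * `|s - s'| by field; rewrite gt_eqF.
  have [j h1] := fout _ _ s'i.
  have h2 := fcore _ _ (ltW si) j.
  have h3 := ler_distD (f s ord0 j) (f s' ord0 j) (ci i ord0 j).
  have h4 := coord_le_norm (f s - f s') j; rewrite !mxE distrC in h4.
  have h5 : eta / 2 * (2 * eta * (l * r)) <= eta / 2 * di i ord0 j.
    by rewrite ler_pM2l // divr_gt0.
  have h6 : eta * eta * l * r <= `|f s - f s'|.
    by move: h1 h2 h3 h4 h5; clear; move=> *; lra.
  have ss : `|s - s'| <= 2.
    by have := ler_normB s s'; move: s1 s1'; clear; move=> *; lra.
  have ss' : eta / 2 * l <= `|s - s'|.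
    have := ler_distD s (sg i) s'; rewrite [`|s' - _|]distrC in s'i.
    by rewrite [`|sg i - s|]distrC; move: si s'i; clear; move=> *; lra.
  have ff : `|f s - f s'| <= 2 * r.
    apply: norm_le_coord => k; have := fdiam s s1 k; have := fdiam s' s1' k.
    have := ler_distD (c ord0 k) (f s ord0 k) (f s' ord0 k).
    rewrite [`|c _ _ - f s' _ _|]distrC !mxE; have /andP[_] := dr k.
    by clear; move=> *; lra.
  split.
    apply: (@le_trans _ _ (2 * b * (eta * eta * l * r))).
      have -> : 2 * b * (eta * eta * l * r) = 2 * r * (eta * eta * l * b) by ring.
      by rewrite bE mulr1 mulrC ler_pM2r.
    apply: ler_pM => //; first by rewrite mulr_ge0 // ltW.
    by rewrite ltW // !mulr_gt0.
  apply: le_trans ff _; apply: (@le_trans _ _ (4 * g * (r * (eta / 2 * l)))).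
    have -> : 4 * g * (r * (eta / 2 * l)) = 2 * r * (eta * l * g) by field.
    by rewrite gE mulr1.
  apply: ler_pM => //; [by rewrite ltW // mulr_gt0| |by rewrite ler_pM2l].
  by rewrite ltW // !mulr_gt0 // divr_gt0.
exists f; last first.
  move=> i s s1; exists (sg i + l * s).
    have := ler_normD (sg i) (l * s); rewrite normrM gtr0_norm // => h.
    have h' : l * `|s| <= l * 1 by rewrite ler_pM2l.
    by have := sg1 i; move: h h' eta0; clear; move=> *; lra.
  have E : sg i + l * s - sg i = l * s by ring.
  rewrite (fin i) E; first by rewrite mulrAC divff ?gt_eqF // mul1r.
  by rewrite normrM gtr0_norm // ger_pMr.
split => //.
move=> s s' s1 s1'.
have [[i si]|sn] := pselect (exists i, `|s - sg i| < (1 - eta / 2) * l).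
  exact: moved si.
have [[i si]|sn'] := pselect (exists i, `|s' - sg i| < (1 - eta / 2) * l).
  by rewrite distrC (distrC (f s)); apply: moved si.
rewrite !fF0; last 2 first.
- by move=> i; rewrite leNgt; apply/negP => h; apply: sn'; exists i.
- by move=> i; rewrite leNgt; apply/negP => h; apply: sn; exists i.
have [h1 h2] := f0L s s'.
have F0lo : 2 * eta * r * `|f0 s - f0 s'| <= `|F0 s - F0 s'|.
  rewrite -ler_pdivlMl; last by rewrite !mulr_gt0.
  apply: norm_le_coord => j; rewrite ler_pdivlMl; last by rewrite !mulr_gt0.
  have := coord_le_norm (F0 s - F0 s') j; rewrite !mxE; apply: le_trans.
  have -> : c ord0 j + d ord0 j * f0 s ord0 j - (c ord0 j + d ord0 j * f0 s' ord0 j)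
    = d ord0 j * (f0 s ord0 j - f0 s' ord0 j) by ring.
  rewrite normrM gtr0_norm //; apply: ler_wpM2r => //.
  by case/andP: (dr j).
have F0up : `|F0 s - F0 s'| <= r * `|f0 s - f0 s'|.
  apply: norm_le_coord => j; rewrite !mxE.
  have -> : c ord0 j + d ord0 j * f0 s ord0 j - (c ord0 j + d ord0 j * f0 s' ord0 j)
    = d ord0 j * (f0 s ord0 j - f0 s' ord0 j) by ring.
  have := coord_le_norm (f0 s - f0 s') j; rewrite !mxE normrM gtr0_norm // => h.
  by apply: ler_pM => //; [exact: ltW|case/andP: (dr j)].
have ss := normr_ge0 (s - s'); have FF := normr_ge0 (F0 s - F0 s').
split.
  apply: (@le_trans _ _ (a * L0 * (2 * eta * r * `|f0 s - f0 s'|))).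
    have -> : a * L0 * (2 * eta * r * `|f0 s - f0 s'|) =
      (2 * eta * a) * (r * (L0 * `|f0 s - f0 s'|)) by ring.
    by rewrite aE mul1r ler_pM2l.
  by apply: ler_pM => //; [exact: ltW|rewrite !mulr_ge0 // ltW].
apply: le_trans F0up _; apply: (@le_trans _ _ (r * (L0 * `|s - s'|))).
  by rewrite ler_pM2l.
rewrite mulrCA; apply: ler_pM => //; [exact: ltW|by rewrite mulr_ge0 // ltW|].
by apply: le_trans La; rewrite ler_peMl // ltW.
Qed.

End Gluing.

(** * Decomposition of sets with few separated points *)

Section Decomposition.
Variables (R : realType) (p : nat).
Local Notation V := 'rV[R]_p.+1.

(** An Assouad dimension bound at scales below [r0]. The points are a family over a finite index
    set, which the separation makes injective. *)
Definition packing (A : set V) (K t r0 : R) : Prop :=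
  forall (r s : R) (I : finType) (S : {set I}) (x : I -> V),
    0 < s <= r -> r <= r0 ->
    (forall i, i \in S -> A (x i)) ->
    (forall i j, i \in S -> j \in S -> `|x i - x j| <= 2 * r) ->
    (forall i j, i \in S -> j \in S -> i != j -> s <= `|x i - x j|) ->
  #|S|%:R <= K * (r / s) `^ t.

(** Here [t < 1] enters: any [M] above [C ^ (1 / (1 - t))] satisfies [C <= M ^ (1 - t)]. *)
Lemma sublinear_power (C t : R) (n : nat) : 0 <= t < 1 -> 0 < C ->
  exists2 M : nat, (n < M)%N & C * M%:R `^ t <= M%:R.
Proof.
move=> /andP[t0 t1] C0.
have t10 : 0 < 1 - t by lra.
pose c := C `^ (1 - t)^-1.
have c0 : 0 <= c := powR_ge0 _ _.
exists (n + Num.truncn c).+1; first by rewrite ltnS leq_addr.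
set M := (n + _).+1.
have M0 : M%:R != 0 :> R by rewrite pnatr_eq0.
have cM : c <= M%:R.
  have /andP[_ /ltW h] := truncn_itv c0; apply: le_trans h _.
  by rewrite ler_nat ltnS leq_addl.
have ME : M%:R = M%:R `^ (1 - t) * M%:R `^ t :> R.
  rewrite -powRD; last by rewrite M0 implybT.
  by rewrite subrK powRr1.
rewrite [leRHS]ME; apply: ler_wpM2r; first exact: powR_ge0.
have <- : c `^ (1 - t) = C.
  by rewrite /c -powRrM mulVf ?gt_eqF // powRr1 // ltW.
by apply: ge0_ler_powR; rewrite ?nnegrE //; exact: ltW.
Qed.

(** [M0] is the ratio of consecutive scales: the first inequality says that the number of nonempty
    cells is at most [M0 / 4]. [M1] is a number of candidate positions for a wall between cells: the
    second says that there are too few separated points to block all of them. *)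
Lemma packing_scales (K t : R) : 0 < K -> 0 <= t < 1 ->
  exists M0 M1 : nat, [/\ (1 < M0)%N, (0 < M1)%N,
    4 * (2 ^+ p.+1 * (K * (2 * M0%:R) `^ t)) <= M0%:R &
    K * (4 * M1%:R * M0%:R) `^ t < M1%:R].
Proof.
move=> K0 t01.
have c1 : 0 < 4 * (2 ^+ p.+1 * (K * 2 `^ t)) :> R.
  by rewrite !mulr_gt0 ?exprn_gt0 // powR_gt0.
have [M0 M01 h0] := sublinear_power 1 t01 c1.
have M00 : 0 < M0%:R :> R by rewrite ltr0n; apply: leq_trans M01.
have c2 : 0 < 2 * (K * (4 * M0%:R) `^ t).
  by rewrite !mulr_gt0 // powR_gt0 // mulr_gt0.
have [M1 M11 h1] := sublinear_power 0 t01 c2.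
exists M0, M1; split => //.
  rewrite powRM //; move: h0; congr (_ <= _); lra.
have M1p : 0 < M1%:R :> R by rewrite ltr0n.
rewrite [4 * _ * _]mulrAC powRM //.
by lra.
Qed.

(** By pigeonhole: the [M1] candidates are [12 * ep] apart. If each were within [3 * ep] of a
    coordinate of a point, these points would be [6 * ep]-separated, and since
    [r / (6 * ep) = 4 * M1 * M0], the packing bound would leave fewer than [M1] of them. *)
Lemma window_gap (A : set V) (K t r0 r w ep : R) (M0 M1 : nat) (A' : set V) :
    packing A K t r0 -> (0 < M0)%N -> (0 < M1)%N ->
    K * (4 * M1%:R * M0%:R) `^ t < M1%:R ->
    0 < r <= r0 -> r = w * M0%:R -> w = 24 * M1%:R * ep ->
    A' `<=` A -> (forall x y, A' x -> A' y -> `|x - y| <= 2 * r) ->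
  forall (j : 'I_p.+1) (a : R), exists g : R,
    a <= g <= a + w / 2 /\ forall x, A' x -> 3 * ep <= `|x ord0 j - g|.
Proof.
move=> pack M0_gt0 M1_gt0 hM1 /andP[r_gt0 rr0] rE wE A'A A'd j a.
have M0p : 0 < M0%:R :> R by rewrite ltr0n.
have M1p : 0 < M1%:R :> R by rewrite ltr0n.
have w0 : 0 < w by rewrite rE pmulr_lgt0 in r_gt0.
have ep0 : 0 < ep by rewrite wE pmulr_rgt0 ?mulr_gt0 in w0.
apply: contrapT => noG.
pose g (q : 'I_M1) := a + 12 * ep * q%:R.
have g_itv q : a <= g q <= a + w / 2.
  have qM : q%:R <= M1%:R :> R by rewrite ler_nat ltnW.
  have h1 : 0 <= ep * q%:R by rewrite mulr_ge0 // ltW.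
  have h2 : ep * q%:R <= ep * M1%:R by rewrite ler_pM2l.
  by rewrite /g wE; apply/andP; split; lra.
have hit q : exists x, A' x /\ `|x ord0 j - g q| < 3 * ep.
  apply: contrapT => noH; apply: noG; exists (g q); split => // x A'x.
  by rewrite leNgt; apply/negP => h; apply: noH; exists x.
have [x xP] := choice hit.
have sep (q q' : 'I_M1) : (q < q')%N -> 6 * ep <= `|x q - x q'|.
  move=> qq'; have [_ h1] := xP q; have [_ h2] := xP q'.
  have h3 : ep * (q%:R + 1) <= ep * q'%:R.
    by rewrite ler_pM2l // natr1 ler_nat.
  have := coord_le_norm (x q - x q') j; rewrite !mxE distrC.
  have := ler_norm (x q' ord0 j - x q ord0 j).
  by move: h1 h2; rewrite !ltr_norml /g => /andP[? ?] /andP[? ?] *; lra.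
have sr : 0 < 6 * ep <= r.
  have h1 : ep * 1 <= ep * M1%:R by rewrite ler_pM2l // ler1n.
  have h2 : w * 1 <= w * M0%:R by rewrite ler_pM2l // ler1n.
  by apply/andP; split; lra.
have H := pack r (6 * ep) _ [set: 'I_M1]%SET x sr rr0.
rewrite cardsT card_ord in H.
have : M1%:R <= K * (r / (6 * ep)) `^ t.
  apply: H => [q _|q q' _ _|q q' _ _ qq'].
  - by apply: A'A; have [] := xP q.
  - by apply: A'd; [have [] := xP q|have [] := xP q'].
  - by move: qq'; rewrite -val_eqE neq_ltn => /orP[] /sep //; rewrite distrC.
have -> : r / (6 * ep) = 4 * M1%:R * M0%:R.
  have h6 : 6 * ep != 0 by rewrite gt_eqF // mulr_gt0.
  by rewrite -[RHS](mulfK h6); congr (_ / _); rewrite rE wE; ring.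
by move=> h; have := lt_le_trans hM1 h; rewrite ltxx.
Qed.

(** Each window of length [w] receives a wall in its first half, at a gap of the coordinates.
    Consecutive walls are thus ordered, and all points keep a distance [3 * ep] from them. *)
Lemma separating_grid (A : set V) (K t r0 r w ep : R) (M0 M1 : nat) (A' : set V)
    (b : 'I_p.+1 -> R) :
    packing A K t r0 -> (0 < M0)%N -> (0 < M1)%N ->
    K * (4 * M1%:R * M0%:R) `^ t < M1%:R ->
    0 < r <= r0 -> r = w * M0%:R -> w = 24 * M1%:R * ep ->
    A' `<=` A -> (forall x y, A' x -> A' y -> `|x - y| <= 2 * r) ->
    (forall x j, A' x -> w <= x ord0 j - b j <= 2 * r + w) ->
  exists G : 'I_p.+1 -> nat -> R,
  [/\ forall j z, b j + w * z%:R <= G j z <= b j + w * z%:R + w / 2,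
      forall j i i', (i < i')%N -> G j i.+1 <= G j i' &
      forall x, A' x -> exists I : {ffun 'I_p.+1 -> 'I_(2 * M0 + 2)}, forall j,
        G j (I j) + 3 * ep <= x ord0 j <= G j (I j).+1 - 3 * ep].
Proof.
move=> pack M0_gt0 M1_gt0 hM1 rr rE wE A'A A'd A'b.
have gap := window_gap pack M0_gt0 M1_gt0 hM1 rr rE wE A'A A'd.
have /andP[r_gt0 rr0] := rr.
have M0p : 0 < M0%:R :> R by rewrite ltr0n.
have M1p : 0 < M1%:R :> R by rewrite ltr0n.
have w0 : 0 < w by rewrite rE pmulr_lgt0 in r_gt0.
have ep0 : 0 < ep by rewrite wE pmulr_rgt0 ?mulr_gt0 in w0.
have [G GP] : exists G : 'I_p.+1 -> nat -> R, forall j z,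
    b j + w * z%:R <= G j z <= b j + w * z%:R + w / 2 /\
    forall x, A' x -> 3 * ep <= `|x ord0 j - G j z|.
  have [G GP] := choice (fun jz : 'I_p.+1 * nat => gap jz.1 (b jz.1 + w * jz.2%:R)).
  by exists (fun j z => G (j, z)) => j z; exact: GP (j, z).
clear pack hM1 gap wE A'A A'd.
exists G; split.
- by move=> j z; case: (GP j z).
- move=> j i i'; rewrite leq_eqVlt => /orP[/eqP ->//|ii'].
  have [/andP[_ h1] _] := GP j i.+1; have [/andP[h2 _] _] := GP j i'.
  have h3 : w * (i.+1%:R + 1) <= w * i'%:R.
    by rewrite ler_pM2l // natr1 ler_nat.
  by lra.
move=> x A'x; suff H j : exists i : 'I_(2 * M0 + 2),
    G j i + 3 * ep <= x ord0 j <= G j i.+1 - 3 * ep.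
  have [I IP] := choice H; exists [ffun j => I j] => j; rewrite ffunE; exact: IP.
have /andP[xb1 xb2] := A'b x j A'x.
pose y := (x ord0 j - b j) / w.
have yw : y * w = x ord0 j - b j by rewrite divfK ?gt_eqF.
have y1 : 1 <= y by rewrite ler_pdivlMr // mul1r.
have y2 : y < (2 * M0 + 2)%:R.
  by rewrite ltr_pdivrMr // natrD natrM mulrDl -mulrA [_ * w]mulrC -rE; lra.
have /andP[z1 z2] := truncn_itv (le_trans ler01 y1).
set z := Num.truncn y in z1 z2.
have zZ : (z < 2 * M0 + 2)%N by rewrite -(ltr_nat R); exact: le_lt_trans z1 y2.
(* Should the wall of its window lie beyond [x], the cell of [x] starts at the previous wall; the
   margin [w] at the left end ensures that there is one. *)
have z0 : (0 < z)%N.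
  rewrite lt0n; apply/eqP => z0; rewrite z0 in z2.
  by have := le_lt_trans y1 z2; rewrite ltxx.
have z1' : w * z%:R <= x ord0 j - b j by rewrite -yw mulrC ler_pM2r.
have z2' : x ord0 j - b j < w * z.+1%:R by rewrite -yw mulrC ltr_pM2l.
clear yw y1 y2 z1 z2.
have [/andP[g1 g2] gx] := GP j z; have {}gx := gx x A'x.
have [h|h] := leP (G j z) (x ord0 j).
  exists (Ordinal zZ) => /=.
  have [/andP[g3 g4] gx'] := GP j z.+1; have {}gx' := gx' x A'x.
  rewrite ger0_norm in gx; last by rewrite subr_ge0.
  rewrite distrC ger0_norm in gx'; last by lra.
  by apply/andP; split; lra.
have zZ' : (z.-1 < 2 * M0 + 2)%N by apply: leq_ltn_trans zZ; exact: leq_pred.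
exists (Ordinal zZ'); rewrite /= prednK //.
have [/andP[g3 g4] gx'] := GP j z.-1; have {}gx' := gx' x A'x.
have zE : z%:R = z.-1%:R + 1 :> R by rewrite natr1 prednK.
rewrite zE in z1'.
rewrite distrC ger0_norm in gx; last by lra.
rewrite ger0_norm in gx'; last by lra.
by apply/andP; split; lra.
Qed.

(* Distinct cells of the same parity are [w / 2]-separated. *)
Lemma card_cells (A : set V) (K t r0 r w : R) (M0 Z : nat) (b : 'I_p.+1 -> R)
    (G : 'I_p.+1 -> nat -> R) (S : {set {ffun 'I_p.+1 -> 'I_Z}})
    (xs : {ffun 'I_p.+1 -> 'I_Z} -> V) :
    packing A K t r0 -> (0 < M0)%N -> 0 < r <= r0 -> r = w * M0%:R ->
    (forall j z, b j + w * z%:R <= G j z <= b j + w * z%:R + w / 2) ->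
    (forall I, I \in S -> A (xs I)) ->
    (forall I I', I \in S -> I' \in S -> `|xs I - xs I'| <= 2 * r) ->
    (forall I j, I \in S -> G j (I j) <= xs I ord0 j <= G j (I j).+1) ->
  #|S|%:R <= 2 ^+ p.+1 * (K * (2 * M0%:R) `^ t).
Proof.
move=> pack M0_gt0 /andP[r_gt0 rr0] rE Gb SA Sd SG.
have M0p : 1 <= M0%:R :> R by rewrite ler1n.
have w0 : 0 < w by rewrite rE pmulr_lgt0 ?ltr0n in r_gt0.
pose par (I : {ffun 'I_p.+1 -> 'I_Z}) := [ffun j => odd (I j)].
have -> : #|S| =
    (\sum_(e : {ffun 'I_p.+1 -> bool}) #|[set I in S | par I == e]%SET|)%N.
  rewrite -sum1_card (partition_big par xpredT) //=.
  by apply: eq_bigr => e _; rewrite -sum1_card; apply: eq_bigl => I; rewrite inE.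
rewrite natr_sum.
have -> : 2 ^+ p.+1 * (K * (2 * M0%:R) `^ t) =
    \sum_(e : {ffun 'I_p.+1 -> bool}) K * (2 * M0%:R) `^ t.
  by rewrite sumr_const card_ffun card_bool card_ord -[RHS]mulr_natl natrX.
apply: ler_sum => e _.
have -> : 2 * M0%:R = r / (w / 2) by rewrite rE; field; rewrite gt_eqF.
apply: (pack _ _ _ _ xs) => //.
- apply/andP; split; first by rewrite divr_gt0.
  have : w * 1 <= w * M0%:R by rewrite ler_pM2l.
  by rewrite -rE => *; lra.
- by move=> I; rewrite inE => /andP[/SA].
- by move=> I I'; rewrite !inE => /andP[IS _] /andP[IS' _]; apply: Sd.
have far (I I' : {ffun 'I_p.+1 -> 'I_Z}) j :
    I \in S -> I' \in S -> ((I j).+1 < I' j)%N ->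
    w / 2 <= `|xs I - xs I'|.
  move=> IS IS' II'.
  have /andP[_ c1] := SG I j IS; have /andP[c2 _] := SG I' j IS'.
  have /andP[_ g1] := Gb j (I j).+1; have /andP[g2 _] := Gb j (I' j).
  have h3 : w * ((I j).+1%:R + 1) <= w * (I' j)%:R.
    by rewrite ler_pM2l // natr1 ler_nat.
  have := coord_le_norm (xs I - xs I') j; rewrite !mxE distrC.
  by have := ler_norm (xs I' ord0 j - xs I ord0 j) => *; lra.
move=> I I'; rewrite inE => /andP[IS /eqP <-]; rewrite inE => /andP[IS' /eqP E] II'.
have [j Ij] : exists j, I j != I' j.
  by apply/existsP; apply: contraNT II'; rewrite negb_exists => /forallP H;
    apply/eqP/ffunP => j; apply/eqP; have := H j; rewrite negbK.
have Ej : odd (I' j) = odd (I j) by have /ffunP/(_ j) := E; rewrite !ffunE.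
move: Ij; rewrite -val_eqE /= neq_ltn => /orP[] lt.
  apply: (far _ _ j) => //; rewrite ltn_neqAle lt andbT.
  by apply/eqP => h; move: Ej; rewrite -h /=; case: (odd _).
rewrite distrC; apply: (far _ _ j) => //; rewrite ltn_neqAle lt andbT.
by apply/eqP => h; move: Ej; rewrite -h /=; case: (odd _).
Qed.

(** One step down in scale. The points have a relative margin [2 * eta] in the parent box and again
    in the small boxes, so the step can be iterated with the same [N], [eta] and [l]; these are
    found from [l = 1 / M0] and [eta = 1 / (24 * M1)]. *)
Lemma box_decomposition (A : set V) (K t r0 : R) : 0 < K -> 0 <= t < 1 ->
    packing A K t r0 ->
  exists (N : nat) (eta l : R), 0 < eta <= 1 / 4 /\ 0 < l <= 1 / 2 /\
  forall (r : R) (c d : V) (A' : set V), 0 < r <= r0 ->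
    (forall j, 2 * eta * r <= d ord0 j <= r) -> A' `<=` A ->
    (forall x, A' x -> forall j, `|x ord0 j - c ord0 j| <= d ord0 j - 2 * eta * r) ->
  exists m (ci di : 'I_m -> V),
  [/\ (m <= N)%N /\ m%:R * l <= 1 / 4,
      forall i j, 2 * eta * (l * r) <= di i ord0 j <= l * r,
      forall i j, `|ci i ord0 j - c ord0 j| + di i ord0 j <= d ord0 j - eta * r,
      forall i j, i != j -> box_sep (2 * eta * (l * r)) (ci i) (di i) (ci j) (di j) &
      forall x, A' x -> exists i, forall j,
        `|x ord0 j - ci i ord0 j| <= di i ord0 j - 2 * eta * (l * r)].
Proof.
move=> K0 t01 pack.
have [M0 [M1 [M0_gt1 M1_gt0 hM0 hM1]]] := packing_scales K0 t01.
have M0p : 2 <= M0%:R :> R by rewrite ler_nat.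
have M1p : 1 <= M1%:R :> R by rewrite ler1n.
have [l lE] : exists l : R, l = M0%:R^-1 by eexists.
have [eta etaE] : exists eta : R, eta = (24 * M1%:R)^-1 by eexists.
have l0 : 0 < l by rewrite lE invr_gt0; lra.
have lM : l * M0%:R = 1 by rewrite lE mulVf // gt_eqF //; lra.
have l1 : l <= 1 / 2 by rewrite lE mul1r lef_pV2 ?posrE //; lra.
have eta0 : 0 < eta by rewrite etaE invr_gt0; lra.
have etaM : 24 * M1%:R * eta = 1 by rewrite etaE mulfV // gt_eqF //; lra.
have eta1 : eta <= 1 / 4.
  have : 1 * eta <= M1%:R * eta by rewrite ler_pM2r.
  by move=> *; lra.
exists M0, eta, l; split; first by rewrite eta0.
split; first by rewrite l0.
move=> r c d A' rr dr A'A A'c; have /andP[r_gt0 rr0] := rr.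
have [w wE] : exists w, w = l * r by eexists.
have [ep epE] : exists ep, ep = eta * w by eexists.
have w0 : 0 < w by rewrite wE mulr_gt0.
have ep0 : 0 < ep by rewrite epE mulr_gt0.
have er0 : 0 < eta * r by rewrite mulr_gt0.
have elr : 2 * ep <= eta * r.
  have : eta * w <= eta * (r / 2).
    by rewrite ler_pM2l // wE mulrC ler_pM2l //; lra.
  by rewrite epE => *; lra.
have rE : r = w * M0%:R by rewrite wE mulrAC lM mul1r.
have wE' : w = 24 * M1%:R * ep by rewrite epE mulrA etaM mul1r.
have M0_gt0 : (0 < M0)%N by exact: ltnW.
rewrite -wE -[2 * eta * w]mulrA -epE.
clear etaE epE lE l1 etaM wE M0p M1p eta1.
have {}A'c x j : A' x -> - (d ord0 j - 2 * (eta * r)) <= x ord0 j - c ord0 j <=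
    d ord0 j - 2 * (eta * r).
  by move=> /A'c/(_ j); rewrite ler_norml mulrA.
have A'd x y : A' x -> A' y -> `|x - y| <= 2 * r.
  move=> xA yA; apply: norm_le_coord => j; rewrite !mxE ler_norml.
  have /andP[? ?] := A'c x j xA; have /andP[? ?] := A'c y j yA.
  by have /andP[_ ?] := dr j; apply/andP; split; lra.
(* The grid starts one window before the box, which provides the left margin of
   [separating_grid]. *)
pose b j := c ord0 j - d ord0 j - w.
have [|G [Gb Gmono cellP]] :=
    @separating_grid A K t r0 r w ep M0 M1 A' b pack
      M0_gt0 M1_gt0 hM1 rr rE wE' A'A A'd.
  move=> x j xA; have /andP[? ?] := A'c x j xA.
  by have /andP[_ ?] := dr j; rewrite /b; apply/andP; split; lra.
clear hM1 wE'.
set Z := (2 * M0 + 2)%N in cellP.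
pose cell (I : {ffun 'I_p.+1 -> 'I_Z}) (x : V) := forall j,
  G j (I j) + 3 * ep <= x ord0 j <= G j (I j).+1 - 3 * ep.
pose S := [set I | `[< exists x, A' x /\ cell I x >]]%SET.
have [xs xsP] : exists xs : {ffun 'I_p.+1 -> 'I_Z} -> V,
    forall I, I \in S -> A' (xs I) /\ cell I (xs I).
  have H I : exists x, I \in S -> A' x /\ cell I x.
    have [|nI] := boolP (I \in S); last by exists 0.
    by rewrite inE => /asboolP[x xP]; exists x.
  by have [xs xsP] := choice H; exists xs.
have cardS : 4 * #|S|%:R <= M0%:R :> R.
  apply: le_trans hM0; rewrite ler_pM2l //.
  apply: (@card_cells A K t r0 r w M0 Z b G S xs) => //.
  - by move=> I /xsP[/A'A].
  - by move=> I I' /xsP[? _] /xsP[? _]; exact: A'd.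
  - by move=> I j /xsP[_ /(_ j)/andP[? ?]]; apply/andP; split; lra.
clear hM0.
(* Shrinking the cells by [ep] at each wall makes distinct boxes [2 * ep] apart, and trimming them
   to the parent box less [eta * r] keeps them off its boundary. The points, [3 * ep] from the walls
   and [2 * eta * r >= eta * r + 2 * ep] from the boundary, retain the margin [2 * ep]. *)
pose lo (I : {ffun 'I_p.+1 -> 'I_Z}) j :=
  Num.max (G j (I j) + ep) (c ord0 j - d ord0 j + eta * r).
pose hi (I : {ffun 'I_p.+1 -> 'I_Z}) j :=
  Num.min (G j (I j).+1 - ep) (c ord0 j + d ord0 j - eta * r).
have lohi I x j : A' x -> cell I x -> lo I j + 2 * ep <= x ord0 j /\
    x ord0 j <= hi I j - 2 * ep.
  move=> A'x /(_ j)/andP[c1 c2]; have /andP[x1 x2] := A'c x j A'x.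
  have : lo I j <= x ord0 j - 2 * ep.
    by rewrite /lo ge_max; apply/andP; split; lra.
  have : x ord0 j + 2 * ep <= hi I j.
    by rewrite /hi le_min; apply/andP; split; lra.
  by move=> *; split; lra.
have lo1 (I : {ffun 'I_p.+1 -> 'I_Z}) j : G j (I j) + ep <= lo I j.
  by rewrite /lo le_max lexx.
have lo2 I j : c ord0 j - d ord0 j + eta * r <= lo I j.
  by rewrite /lo le_max lexx orbT.
have hi1 (I : {ffun 'I_p.+1 -> 'I_Z}) j : hi I j <= G j (I j).+1 - ep.
  by rewrite /hi ge_min lexx.
have hi2 I j : hi I j <= c ord0 j + d ord0 j - eta * r.
  by rewrite /hi ge_min lexx orbT.
(* The bounds in coordinate [j] depend on [I j] alone. Hence boxes that differ only in their first
   index have the same column exactly, as the first case of [box_sep] requires. *)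
have lohiE (I I' : {ffun 'I_p.+1 -> 'I_Z}) j :
    I j = I' j -> lo I j = lo I' j /\ hi I j = hi I' j.
  by move=> E; rewrite /lo /hi E.
move: lo hi lohi lo1 lo2 hi1 hi2 lohiE => lo hi lohi lo1 lo2 hi1 hi2 lohiE.
pose cS (i : 'I_#|S|) : V := \row_j ((lo (enum_val i) j + hi (enum_val i) j) / 2).
pose dS (i : 'I_#|S|) : V := \row_j ((hi (enum_val i) j - lo (enum_val i) j) / 2).
exists #|S|, cS, dS; split.
- split.
    by rewrite -(ler_nat R); have : 0 <= #|S|%:R :> R by []; move=> *; lra.
  have : 4 * #|S|%:R * l <= M0%:R * l by rewrite ler_pM2r.
  by rewrite [M0%:R * l]mulrC lM => *; lra.
- move=> i j; rewrite mxE; have [A'x cx] := xsP _ (enum_valP i).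
  have [h1 h2] := lohi _ _ j A'x cx.
  have h3 := hi1 (enum_val i) j; have h4 := lo1 (enum_val i) j.
  have /andP[_ g1] := Gb j (enum_val i j).+1.
  have /andP[g2 _] := Gb j (enum_val i j).
  rewrite -natr1 in g1.
  by apply/andP; split; lra.
- move=> i j; rewrite !mxE.
  have h3 := hi2 (enum_val i) j; have h4 := lo2 (enum_val i) j.
  by rewrite -lerBrDr ler_norml; apply/andP; split; lra.
- have sep (I I' : {ffun 'I_p.+1 -> 'I_Z}) j :
      (I j < I' j)%N -> 2 * ep <= lo I' j - hi I j.
    move=> /(Gmono j) h; have := hi1 I j; have := lo1 I' j => *; lra.
  have sep' (i i' : 'I_#|S|) j : enum_val i j != enum_val i' j ->
      dS i ord0 j + dS i' ord0 j + 2 * ep <= `|cS i ord0 j - cS i' ord0 j|.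
    rewrite -val_eqE neq_ltn !mxE => /orP[] /sep h.
      by rewrite distrC; apply: le_trans (ler_norm _); lra.
    by apply: le_trans (ler_norm _); lra.
  move=> i i' ii'.
  have [[j j0 Ij]|H] := pselect
      (exists2 j, j != ord0 & enum_val i j != enum_val i' j).
    by right; exists j => //; exact: sep'.
  have {}H j : j != ord0 -> enum_val i j = enum_val i' j.
    by move=> j0; apply/eqP/negP => /negP h; apply: H; exists j.
  left; split.
    by move=> j j0; rewrite !mxE; case: (lohiE _ _ _ (H j j0)) => -> ->.
  apply: sep'; apply: contraNN ii' => /eqP E0; apply/eqP/enum_val_inj/ffunP => j.
  by have [->//|] := eqVneq j ord0; exact: H.
- move=> x A'x; have [I cx] := cellP x A'x.
  have IS : I \in S by rewrite inE; apply/asboolP; exists x.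
  exists (enum_rank_in IS I) => j; rewrite !mxE enum_rankK_in //.
  have [h1 h2] := lohi _ _ j A'x cx.
  by rewrite ler_norml; apply/andP; split; lra.
Qed.

End Decomposition.

(** * Passage to the limit *)

Section Curves_through_porous_sets.
Variables (R : realType) (p : nat).
Local Notation V := 'rV[R]_p.+1.

(** Induction on the number [k] of scales, for all boxes and subsets of [A] at once: the box is
    decomposed, the induction hypothesis provides curves in the small boxes, and these are
    substituted into a threading curve. The constant [L] is the same for all [k]. *)
Lemma approximating_curves (A : set V) (K t r0 : R) : 0 < K -> 0 <= t < 1 ->
    packing A K t r0 ->
  exists eta L l : R, [/\ 0 < eta <= 1 / 4, 0 < L, 0 < l <= 1 / 2 &
  forall (k : nat) (r : R) (c d : V) (A' : set V), 0 < r <= r0 ->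
    (forall j, 2 * eta * r <= d ord0 j <= r) -> A' `<=` A ->
    (forall x, A' x -> forall j, `|x ord0 j - c ord0 j| <= d ord0 j - 2 * eta * r) ->
  exists2 f, box_curve eta L r c d f &
    forall x, A' x -> exists2 s, `|s| <= 1 & `|x - f s| <= r * l ^+ k].
Proof.
move=> K0 t01 pack.
have [N [eta [l [eta01 [l01 dec]]]]] := box_decomposition K0 t01 pack.
have /andP[eta0 eta1] := eta01; have /andP[l0 l1] := l01.
have eta01' : 0 < eta <= 1 / 2 by apply/andP; split => //; lra.
have l01' : 0 < l <= 1 by apply/andP; split => //; lra.
have [L L1 glue] := box_curve_glue p N eta01' l01'.
have L0 : 0 < L.
  by have := lt_le_trans ltr01 L1; rewrite pmulr_rgt0 // mulr_gt0.
exists eta, L, l; split => //.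
elim=> [|k IH] r c d A' /andP[r_gt0 rr0] dr A'A A'c.
  exists (fun s => c + (s * d ord0 ord0) *: delta_mx ord0 ord0).
    exact: box_curve_axis.
  move=> x A'x; exists 0; first by rewrite normr0.
  rewrite mul0r scale0r addr0 expr0 mulr1; apply: norm_le_coord => j.
  rewrite !mxE; have := A'c x A'x j; have /andP[_ dj] := dr j.
  have : 0 < eta * r by rewrite mulr_gt0.
  by move=> *; lra.
have rr : 0 < r <= r0 by rewrite r_gt0.
have [m [ci [di [[mN ml] did cdi sep cover]]]] := dec r c d A' rr dr A'A A'c.
have lr0 : 0 < l * r by rewrite mulr_gt0.
have lr1 : 0 < l * r <= r0.
  by rewrite lr0 /=; apply: le_trans rr0; rewrite ger_pMl //; lra.
pose Ai i := A' `&` [set x | forall j : 'I_p.+1,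
  `|x ord0 j - ci i ord0 j| <= di i ord0 j - 2 * eta * (l * r)].
have /choice[fi fiP] i : exists f, box_curve eta L (l * r) (ci i) (di i) f /\
    forall x, Ai i x -> exists2 s, `|s| <= 1 & `|x - f s| <= l * r * l ^+ k.
  have [||f fb fA] := IH (l * r) (ci i) (di i) (Ai i) lr1 (did i).
  - by move=> x [/A'A].
  - by move=> x [].
  by exists f.
have [i j||f fb fin] := glue r c d m ci di fi r_gt0 dr mN ml _ cdi sep.
- by case/andP: (did i j).
- by move=> i; case: (fiP i).
exists f => // x A'x; have [i xi] := cover x A'x.
have [_ /(_ x)] := fiP i; case=> // s s1 xs.
have [s' s'1 ss'] := fin i s s1; exists s' => //.
by rewrite ss' exprS mulrCA mulrA.
Qed.

(** An ultrafilter converges to each of its cluster points, and compactness supplies one. *)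
Lemma ultra_compact_cvg (T : Type) (X : topologicalType) (G : set_system T)
    (f : T -> X) (C : set X) : UltraFilter G -> compact C -> (forall k, C (f k)) ->
  exists2 q, C q & f k @[k --> G] --> q.
Proof.
move=> UG cC Cf.
have PG : ProperFilter G := ultra_proper.
have [q [Cq clq]] : C `&` cluster (f k @[k --> G]) !=set0.
  by apply: cC; exact: (@filterE _ G _ _ Cf).
exists q => // U Uq; have [//|GU] := in_ultra_setVsetC (f @^-1` U) UG.
have [x [nUx Ux]] := clq (~` U) U GU Uq.
by case: nUx.
Qed.

(** Along an ultrafilter finer than [\oo] the curves converge at all parameters at once, and the
    bi-Lipschitz bounds pass to the limit. A point of [A] is attained at the limit of parameters at
    which the curves come near it. *)
Lemma limit_curve (f : nat -> R -> V) (r L B : R) (A : set V) (eps : nat -> R) :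
    0 < r -> 0 < L -> eps @ \oo --> 0 ->
    (forall k s s', `|s| <= 1 -> `|s'| <= 1 ->
      r * `|s - s'| <= L * `|f k s - f k s'| /\
      `|f k s - f k s'| <= L * (r * `|s - s'|)) ->
    (forall k s, `|s| <= 1 -> `|f k s| <= B) ->
    (forall k x, A x -> exists2 s, `|s| <= 1 & `|x - f k s| <= eps k) ->
  exists F : R -> V,
    (forall s s', `|s| <= 1 -> `|s'| <= 1 ->
      r * `|s - s'| <= L * `|F s - F s'| /\
      `|F s - F s'| <= L * (r * `|s - s'|)) /\
    (forall x, A x -> exists2 s, `|s| <= 1 & F s = x).
Proof.
move=> r0 L0 eps0 fL fB fA.
have [G [UG ooG]] := @ultraFilterLemma nat \oo _.
have PG : ProperFilter G := ultra_proper.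
have [F FP] : exists F : R -> V, forall s, `|s| <= 1 ->
    f k s @[k --> G] --> F s.
  have H s : exists y : V, `|s| <= 1 -> f k s @[k --> G] --> y.
    have [s1|] := pselect (`|s| <= 1); last by exists 0.
    have Bc : compact [set v : V | forall i, `[(- B), B]%classic (v ord0 i)].
      by apply: (@rV_compact R p.+1 (fun=> `[(- B), B]%classic)) => i;
        exact: segment_compact.
    have [|y _ fy] := @ultra_compact_cvg _ _ G (fun k => f k s) _ UG Bc.
      move=> k i /=; rewrite in_itv /= -ler_norml.
      exact: le_trans (coord_le_norm _ _) (fB k s s1).
    by exists y.
  by have [F FP] := choice H; exists F.
have dist_cvg s s' : `|s| <= 1 -> `|s'| <= 1 ->
    `|f k s - f k s'| @[k --> G] --> `|F s - F s'|.
  by move=> s1 s1'; apply: cvg_norm; apply: cvgB; exact: FP.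
have FL s s' : `|s| <= 1 -> `|s'| <= 1 ->
    r * `|s - s'| <= L * `|F s - F s'| /\ `|F s - F s'| <= L * (r * `|s - s'|).
  move=> s1 s1'; split.
    apply: (@ler_cvg_to _ G _ R (fun=> r * `|s - s'|)
      (fun k => L * `|f k s - f k s'|)).
    - exact: cvg_cst.
    - by apply: cvgM; [exact: cvg_cst|exact: dist_cvg].
    - by apply: filterE => k; case: (fL k s s' s1 s1').
  apply: (@ler_cvg_to _ G _ R (fun k => `|f k s - f k s'|)
      (fun=> L * (r * `|s - s'|))).
  - exact: dist_cvg.
  - exact: cvg_cst.
  - by apply: filterE => k; case: (fL k s s' s1 s1').
exists F; split => // x Ax.
have near_x k : exists s, `|s| <= 1 /\ `|x - f k s| <= eps k.
  by have [s s1 xs] := fA k x Ax; exists s.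
have [sk skP] := choice near_x.
have [|s s1 sks] := @ultra_compact_cvg _ _ G sk _ UG (@segment_compact R (-1) 1).
  by move=> k; rewrite /= in_itv /= -ler_norml; case: (skP k).
have {}s1 : `|s| <= 1 by move: s1; rewrite /= in_itv /= -ler_norml.
exists s => //; apply/eqP; rewrite -subr_eq0 -normr_le0 distrC.
have epsG : eps @ G --> 0 by apply: cvg_trans eps0 => U /ooG.
(* The way from [x] to [F s] leads through [f k (sk k)] and [f k s]; each of the three distances
   tends to 0. *)
have ub : eps k + L * (r * `|sk k - s|) + `|f k s - F s| @[k --> G]
    --> 0 + L * (r * `|s - s|) + `|F s - F s|.
  apply: cvgD; last by apply: cvg_norm; apply: cvgB; [exact: FP|exact: cvg_cst].
  apply: cvgD => //; apply: cvgM; first exact: cvg_cst.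
  apply: cvgM; first exact: cvg_cst.
  apply: cvg_norm.
  by apply: cvgB => //; exact: cvg_cst.
rewrite !subrr !normr0 !mulr0 !addr0 in ub.
apply: (@ler_cvg_to _ G _ R (fun=> `|x - F s|) _ _ _ _ ub); first exact: cvg_cst.
apply: filterE => k; have [h1 h2] := skP k; have [_ h3] := fL k _ _ h1 s1.
have := ler_distD (f k (sk k)) x (F s); have := ler_distD (f k s) (f k (sk k)) (F s).
by move=> *; lra.
Qed.

End Curves_through_porous_sets.

(** * Sets of positive finite density *)

Section Euclidean_norm.
Variables (R : realType) (p : nat).
Implicit Types x y : 'rV[R]_p.+1.

Lemma norm_le_enorm x : `|x| <= enorm x.
Proof.
apply: norm_le_coord => j; rewrite -sqrtr_sqr ler_sqrt; last first.
  by apply: sumr_ge0 => i _; exact: sqr_ge0.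
by rewrite (bigD1 j) //= lerDl; apply: sumr_ge0 => i _; exact: sqr_ge0.
Qed.

Lemma enorm_le_norm x : enorm x <= p.+1%:R * `|x|.
Proof.
have n0 : 0 <= p.+1%:R * `|x| by rewrite mulr_ge0.
rewrite -(ger0_norm n0) -sqrtr_sqr ler_sqrt ?sqr_ge0 //.
apply: (@le_trans _ _ (\sum_(i < p.+1) `|x| ^+ 2)).
  apply: ler_sum => i _; rewrite -real_normK ?num_real // ?lerXn2r ?nnegrE //.
  exact: coord_le_norm.
rewrite sumr_const card_ord -[leLHS]mulr_natl exprMn ler_wpM2r ?sqr_ge0 //.
by rewrite expr2 -natrM ler_nat leq_pmulr.
Qed.

Lemma closed_eclosed_ball x (r : R) : closed (eclosed_ball x r).
Proof.
have -> : eclosed_ball x r = (fun y => enorm (y - x)) @^-1` [set z | z <= r] by [].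
apply: preimage_closed; last exact: closed_le.
move=> y _; pose g (z : 'rV[R]_p.+1) := \sum_(i < p.+1) (z - x) ord0 i ^+ 2.
suff gc : g z @[z --> y] --> g y.
  exact: (@continuous_comp _ _ _ g (@Num.sqrt R) y gc (@sqrt_continuous R _)).
apply: (@cvg_big R _ _ _ _ _ _ (nbhs y)) => [|i _]; first exact: add_continuous.
rewrite expr2; under eq_cvg do rewrite expr2.
suff c : (z - x) ord0 i @[z --> y] --> (y - x) ord0 i by exact: cvgM.
rewrite mxE; under eq_cvg do rewrite mxE.
have cy := @coord_continuous R 1 p.+1 ord0 i y.
have cx : (fun=> (- x) ord0 i) @ nbhs y --> (- x) ord0 i by exact: cvg_cst.
exact: cvgD cy cx.
Qed.

Lemma closed_borel_set (T : topologicalType) (F : set T) : closed F -> borel_set F.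
Proof.
move=> cF S [[S0 SD SU] oS]; rewrite -(setCK F) -setTD; apply: SD; apply: oS.
exact: closed_openC.
Qed.

End Euclidean_norm.

Section Density_pieces.
Variables (R : realType) (p : nat).
Local Notation V := 'rV[R]_p.+1.
Variable mu : {outer_measure set V -> \bar R}.
Hypothesis mu_radon : radon mu.

(** The sets [B i] are cut off one at a time, each by its own Carathéodory property; the remainder
    of [X] can be arbitrary. *)
Lemma caratheodory_packing (T : choiceType) (s : seq T) (B : T -> set V) (X : set V)
    (a : R) : uniq s ->
    (forall i, i \in s ->
      [/\ mu.-caratheodory (B i), B i `<=` X & (a%:E <= mu (B i))%E]) ->
    (forall i j, i \in s -> j \in s -> i != j -> B i `&` B j = set0) ->
  ((a *+ size s)%:E <= mu X)%E.
Proof.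
elim: s X => [|i s IH] X /=; first by move=> *; rewrite mulr0n outer_measure_ge0.
move=> /andP[i_s us] sB sep.
have [cB BX aB] := sB i (mem_head _ _).
rewrite (cB X) mulrS EFinD; apply: leeD.
  by rewrite (setIidr BX).
apply: IH => //.
- move=> j js; have [cj jX aj] := sB j (mem_behead (s := i :: s) js).
  split => // y Bjy; split; first exact: jX.
  move=> Biy; have ij : i != j by apply: contraNneq i_s => ->.
  have := sep i j (mem_head _ _) (mem_behead (s := i :: s) js) ij.
  by move=> /seteqP[/(_ y) h _]; apply: h.
- by move=> j k js ks; apply: sep; rewrite in_cons ?js ?ks orbT.
Qed.

(** A single integer controls both density constants and the range of radii, which leaves a
    countable family of pieces. *)
Definition density_piece (t : R) (k : nat) : set V :=
  [set x | forall r : R, 0 < r <= k.+1%:R^-1 ->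
    ((r `^ t / k.+1%:R)%:E <= mu (eclosed_ball x r) <= (k.+1%:R * r `^ t)%:E)%E].

(** The balls of radius [s / 3] around the points are disjoint and lie in one ball of radius
    [3 * p.+1 * r], the factor [p.+1] coming from the comparison of the norms. Lower density bounds
    for the former and the upper one for the latter limit their number; [r0] is such that all radii
    are admissible. *)
Lemma packing_density_piece (t : R) (k : nat) : 0 <= t ->
  packing (density_piece t k) (k.+1%:R ^+ 2 * (9 * p.+1%:R) `^ t) t
    (3 * p.+1%:R * k.+1%:R)^-1.
Proof.
move=> t0 r s I S x /andP[s0 sr] rr0 SA Sd Ss.
have r0 : 0 < r := lt_le_trans s0 sr.
have k0 : 0 < k.+1%:R :> R by [].
have n0 : 0 < p.+1%:R :> R by [].
have n1 : 1 <= p.+1%:R :> R by rewrite ler1n.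
have nr : 0 < 3 * p.+1%:R * r <= k.+1%:R^-1.
  rewrite !mulr_gt0 //=; move: rr0.
  by rewrite invfM ler_pdivlMl ?mulr_gt0.
have rnr : r <= 3 * p.+1%:R * r.
  have : 1 * r <= p.+1%:R * r by rewrite ler_pM2r.
  by move=> *; lra.
have s3 : 0 < s / 3 <= k.+1%:R^-1.
  have /andP[_ h] := nr; apply/andP; split; first by lra.
  by apply: le_trans h; apply: le_trans rnr; lra.
have [i0 i0S|S0] := pickP [in S]; last first.
  rewrite eq_card0 // !mulr_ge0 ?sqr_ge0 ?powR_ge0 //.
have /andP[_ up] := SA _ i0S _ nr.
have := @caratheodory_packing _ (enum S) (fun i => eclosed_ball (x i) (s / 3))
  (eclosed_ball (x i0) (3 * p.+1%:R * r)) ((s / 3) `^ t / k.+1%:R) (enum_uniq _).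
rewrite -cardE => H.
have {H} lo : ((((s / 3) `^ t / k.+1%:R) *+ #|S|)%:E
    <= mu (eclosed_ball (x i0) (3 * p.+1%:R * r)))%E.
  apply: H.
  - move=> i; rewrite mem_enum => iS; split.
    + have [_ [cB _]] := mu_radon; apply: cB.
      by apply: closed_borel_set; exact: closed_eclosed_ball.
    + move=> y; rewrite /eclosed_ball /= => yi.
      apply: le_trans (enorm_le_norm _) _.
      rewrite [3 * _]mulrC -mulrA ler_pM2l //.
      have h1 := le_trans (norm_le_enorm _) yi.
      have h2 := Sd _ _ iS i0S; have h3 := ler_distD (x i) y (x i0).
      by lra.
    + by case/andP: (SA _ iS _ s3).
  - move=> i j; rewrite !mem_enum => iS jS ij; apply/seteqP; split => // y.
    rewrite /eclosed_ball /= => -[yi yj].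
    have h1 := le_trans (norm_le_enorm _) yi.
    have h2 := le_trans (norm_le_enorm _) yj.
    have h3 := Ss _ _ iS jS ij; have := ler_distD y (x i) (x j).
    by rewrite [`|x i - y|]distrC => *; lra.
have := le_trans lo up; rewrite lee_fin -mulr_natl.
have s3t : 0 < (s / 3) `^ t by rewrite powR_gt0 // divr_gt0.
have -> : 3 * p.+1%:R * r = s / 3 * (9 * p.+1%:R * (r / s)).
  by field; rewrite gt_eqF.
have rs0 : 0 <= r / s by rewrite divr_ge0 // ltW.
have s30 : 0 <= s / 3 by rewrite divr_ge0 // ltW.
have n9 : 0 <= 9 * p.+1%:R :> R by rewrite mulr_ge0.
rewrite (powRM _ s30) ?(mulr_ge0 n9) // (powRM _ n9 rs0).
rewrite mulrA ler_pdivrMr // => h.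
rewrite -(ler_pM2r s3t); apply: le_trans h _.
by rewrite expr2; lra.
Qed.

End Density_pieces.

Section Carrying_curves.
Variables (R : realType) (p : nat).
Local Notation V := 'rV[R]_p.+1.

(** The initial box is a cube of half-width [r0]; points within [r0 / 2] of its center have the
    margin [2 * eta * r0] because [eta <= 1 / 4]. *)
Lemma porous_piece_in_curve (A : set V) (K t r0 : R) (c : V) :
    0 < K -> 0 <= t < 1 -> 0 < r0 -> packing A K t r0 ->
  exists2 G : set V, bilipschitz_curve G & A `&` [set x | `|x - c| <= r0 / 2] `<=` G.
Proof.
move=> K0 t01 r00 pack.
have [eta [L [l [/andP[eta0 eta1] L0 /andP[l0 l1] app]]]] :=
  approximating_curves K0 t01 pack.
set A' := _ `&` _.
have rr0 : 0 < r0 <= r0 by rewrite r00 lexx.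
pose d : V := const_mx r0.
have er : eta * r0 <= 1 / 4 * r0 by rewrite ler_pM2r.
have curve k : exists f : R -> V, box_curve eta L r0 c d f /\
    forall x, A' x -> exists2 s, `|s| <= 1 & `|x - f s| <= r0 * l ^+ k.
  have [|||f fb fA] := app k r0 c d A' rr0; last by exists f.
  - by move=> j; rewrite mxE lexx andbT; lra.
  - by move=> x [].
  - move=> x [_ xc] j; rewrite mxE; have := coord_le_norm (x - c) j.
    by rewrite /= !mxE in xc * => *; lra.
have [f fP] := choice curve.
(* The pinned endpoint is common to all the curves, and with the Lipschitz bound it confines them to
   one ball. *)
have f1 k : f k 1 = c + r0 *: delta_mx ord0 ord0.
  by case: (fP k) => -[_ h _] _; rewrite h ?normr1 ?mul1r ?mxE //; lra.
have fL k s s' : `|s| <= 1 -> `|s'| <= 1 ->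
    r0 * `|s - s'| <= L * `|f k s - f k s'| /\
    `|f k s - f k s'| <= L * (r0 * `|s - s'|).
  by case: (fP k) => -[h _ _] _; exact: h.
have fB k s : `|s| <= 1 -> `|f k s| <= L * (r0 * 2) + `|c + r0 *: delta_mx ord0 ord0|.
  move=> s1; have [|_ h] := fL k s 1 s1; first by rewrite normr1.
  rewrite -[f k s](subrK (f k 1)) -(f1 k); apply: le_trans (ler_normD _ _) _.
  rewrite lerD2r; apply: le_trans h _; rewrite !ler_pM2l //.
  by apply: le_trans (ler_normB _ _) _; rewrite normr1; lra.
have eps0 : (fun k => r0 * l ^+ k) @ \oo --> 0.
  rewrite -[X in _ --> X](mulr0 r0).
  apply: cvgM; first exact: cvg_cst.
  apply: cvg_expr.
  by rewrite gtr0_norm //; lra.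
have [F [FL FA]] := limit_curve r00 L0 eps0 fL fB (fun k => proj2 (fP k)).
(* The second summand bounds the contraction and the third the expansion after the change of
   parameter interval and of norm. *)
pose M := 1 + L / (2 * r0) + p.+1%:R * (L * (r0 * 2)).
have LL : 0 < L / (2 * r0) by rewrite divr_gt0 // mulr_gt0.
have LL' : 0 < p.+1%:R * (L * (r0 * 2)) by rewrite !mulr_gt0.
have M0 : 0 < M by rewrite /M; lra.
pose g (s : R) : R := 2 * s - 1.
exists ((F \o g) @` `[0, 1]).
  exists (F \o g) => //; exists M; first by rewrite /M; lra.
  move=> x y; rewrite /= !in_itv /= => /andP[x0 x1] /andP[y0 y1].
  have gx : `|g x| <= 1 by rewrite /g ler_norml; apply/andP; split; lra.
  have gy : `|g y| <= 1 by rewrite /g ler_norml; apply/andP; split; lra.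
  have gxy : `|g x - g y| = 2 * `|x - y|.
    by rewrite /g (_ : _ - _ = 2 * (x - y)); [rewrite normrM gtr0_norm|lra].
  have [h1 h2] := FL _ _ gx gy; rewrite gxy in h1 h2.
  have h3 := norm_le_enorm (F (g x) - F (g y)).
  have h4 := enorm_le_norm (F (g x) - F (g y)).
  have xy0 := normr_ge0 (x - y).
  apply/andP; split.
    rewrite ler_pdivrMl //.
    apply: (@le_trans _ _ (L / (2 * r0) * `|F (g x) - F (g y)|)).
      rewrite mulrAC ler_pdivlMr ?mulr_gt0 //.
      by lra.
    apply: ler_pM => //; first exact: ltW.
    by rewrite /M; lra.
  apply: le_trans h4 _; apply: (@le_trans _ _ (p.+1%:R * (L * (r0 * 2)) * `|x - y|)).
    by rewrite -!mulrA ler_pM2l.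
  by apply: ler_wpM2r => //; rewrite /M; lra.
move=> x /FA[s s1 <-]; exists ((s + 1) / 2).
  move: s1; rewrite ler_norml /= in_itv /= => /andP[? ?].
  by apply/andP; split; lra.
by rewrite /= /g; congr F; lra.
Qed.

Lemma density_pieces_cover (mu : {outer_measure set V -> \bar R}) (t : R) (x : V) :
    0 <= t -> (0 < lower_density mu t x)%E -> (upper_density mu t x < +oo)%E ->
  exists k, density_piece mu t k x.
Proof.
move=> t0; rewrite /lower_density /upper_density limf_einfE limf_esupE.
have right V : nbhs (0^'+ : set_system R) V -> exists2 e : R, 0 < e &
    forall r, 0 < r < e -> V r.
  rewrite nbhs_nearE => /nbhs_ballP[e /= e0 H]; exists e => // r /andP[r0 re].
  by apply: H => //=; rewrite /ball /= sub0r normrN gtr0_norm.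
have div_le (a r : R) : 0 < r -> (a%:E <= density_ratio mu t x r)%E =
    ((r `^ t * a)%:E <= mu (eclosed_ball x r))%E.
  move=> r0; have rt : 0 < r `^ t by rewrite powR_gt0.
  by rewrite /density_ratio inver gt_eqF // lee_pdivlMr // -EFinM mulrC.
have le_div (a r : R) : 0 < r -> (density_ratio mu t x r <= a%:E)%E =
    (mu (eclosed_ball x r) <= (a * r `^ t)%:E)%E.
  move=> r0; have rt : 0 < r `^ t by rewrite powR_gt0.
  by rewrite /density_ratio inver gt_eqF // lee_pdivrMr.
move=> /ereal_sup_gt[_ [U0 /right[e0 e00 U0e] <-] infU].
move=> /ereal_inf_lt[_ [U1 /right[e1 e10 U1e] <-] supU].
have [a a0 aU] : exists2 a : R, 0 < a &
    forall r, 0 < r < e0 -> (a%:E <= density_ratio mu t x r)%E.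
  have inf_le r : 0 < r < e0 ->
      (ereal_inf [set density_ratio mu t x s | s in U0] <= density_ratio mu t x r)%E.
    by move=> re; apply: ereal_inf_lbound; exists r => //; exact: U0e.
  move: infU inf_le; case: (ereal_inf _) => [a||//] a0 H.
    by exists a.
  (* The infimum can be [+oo], and then any positive [a] will do. *)
  exists 1 => // r re; apply: le_trans (H r re); exact: leey.
have [b bU] : exists b : R,
    forall r, 0 < r < e1 -> (density_ratio mu t x r <= b%:E)%E.
  have sup_ge r : 0 < r < e1 ->
      (density_ratio mu t x r <= ereal_sup [set density_ratio mu t x s | s in U1])%E.
    by move=> re; apply: ereal_sup_ubound; exists r => //; exact: U1e.
  move: supU sup_ge; case: (ereal_sup _) => [b||] // _ H; first by exists b.
  by exists 0 => r re; apply: le_trans (H r re) _; exact: leNye.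
(* An integer above all four summands makes both density constants and both ranges of radii
   admissible. *)
pose c : R := a^-1 + `|b| + e0^-1 + e1^-1.
have c0 : 0 <= c by rewrite /c !addr_ge0 // invr_ge0 ltW.
exists (Num.truncn c) => r /andP[r0 rk].
have /andP[_ ck] := truncn_itv c0.
set k := (Num.truncn c).+1%:R : R in rk ck *.
have ia : 0 < a^-1 by rewrite invr_gt0.
have ie0 : 0 < e0^-1 by rewrite invr_gt0.
have ie1 : 0 < e1^-1 by rewrite invr_gt0.
have b0 := normr_ge0 b.
have k0 : 0 < k by apply: le_lt_trans ck.
have re0 : r < e0.
  apply: le_lt_trans rk _; rewrite -[e0]invrK ltf_pV2 ?posrE //.
  by apply: le_lt_trans ck; rewrite /c; lra.
have re1 : r < e1.
  apply: le_lt_trans rk _; rewrite -[e1]invrK ltf_pV2 ?posrE //.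
  by apply: le_lt_trans ck; rewrite /c; lra.
have rt : 0 < r `^ t by rewrite powR_gt0.
apply/andP; split.
  have : (a%:E <= density_ratio mu t x r)%E by apply: aU; rewrite r0.
  rewrite div_le //; apply: le_trans; rewrite lee_fin ler_pM2l //.
  rewrite -[a]invrK lef_pV2 ?posrE //.
  by apply: ltW; apply: le_lt_trans ck; rewrite /c; lra.
have : (density_ratio mu t x r <= b%:E)%E by apply: bU; rewrite r0.
rewrite le_div // => /le_trans; apply; rewrite lee_fin ler_pM2r //.
apply: ltW; apply: le_lt_trans (ler_norm b) _.
by apply: le_lt_trans ck; rewrite /c; lra.
Qed.

End Carrying_curves.

Theorem theoremB (R : realType) (n : nat) (n_gt0 : (0 < n)%N)
  (mu : {outer_measure set 'rV[R]_n -> \bar R}) (mu_radon : radon mu)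
  (t : R) (t_ge0 : 0 <= t) (t_lt1 : t < 1) :
  carried_by_bilipschitz_curves (mu_t_plus mu t).
Proof.
case: n n_gt0 mu mu_radon => // p _ mu mu_radon.
pose r0 (k : nat) : R := (3 * p.+1%:R * k.+1%:R)^-1.
have r00 k : 0 < r0 k by rewrite invr_gt0 !mulr_gt0.
have t01 : 0 <= t < 1 by rewrite t_ge0.
(* For each piece, the centers form a lattice of mesh [r0 k / 2], so that the cubes of this
   half-width cover the space, with countably many pairs of a piece and a center in total. *)
pose c (kz : nat * 'rV[int]_p.+1) : 'rV[R]_p.+1 :=
  \row_j (r0 kz.1 / 2 * (kz.2 ord0 j)%:~R).
have piece kz : exists G : set 'rV[R]_p.+1, bilipschitz_curve G /\
    density_piece mu t kz.1 `&` [set x | `|x - c kz| <= r0 kz.1 / 2] `<=` G.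
  have K0 : 0 < kz.1.+1%:R ^+ 2 * (9 * p.+1%:R) `^ t :> R.
    by rewrite mulr_gt0 ?exprn_gt0 // powR_gt0 mulr_gt0.
  have [G ? ?] := porous_piece_in_curve (c kz) K0 t01 (r00 kz.1)
    (packing_density_piece mu_radon (k := kz.1) t_ge0).
  by exists G.
have [G GP] := choice piece.
exists (range G); split.
- exact: card_le_trans (card_image_le _ _) (countableP _).
- by move=> _ [kz _ <-]; case: (GP kz).
rewrite /mu_t_plus /= /orestr (_ : _ `&` _ = set0) ?outer_measure0 //.
apply/seteqP; split => // x [[lo _ up] nG].
have [k xk] := density_pieces_cover t_ge0 lo up.
apply: nG; pose z : 'rV[int]_p.+1 := \row_j Num.floor (x ord0 j / (r0 k / 2)).
exists (G (k, z)); first by exists (k, z).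
have [_] := GP (k, z); apply; split => //=.
have h0 : 0 < r0 k / 2 by rewrite divr_gt0.
apply: norm_le_coord => j; rewrite !mxE /=.
have /andP[f1 f2] := floor_itv (x ord0 j / (r0 k / 2)).
move: f1 f2; rewrite ler_pdivlMr // ltr_pdivrMr // intrD.
set w := _%:~R; set h := r0 k / 2 => f1 f2.
rewrite ger0_norm; last by lra.
by rewrite mulrDl mul1r in f2; lra.
Qed.
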